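(* Let $A$ and $B$ be graded bialgebras. For any graded algebra $C$, there is a natural bijection $$\widehat{\mathscr R}(C)\stackrel{\simeq}{\longrightarrow}\mathrm{Hom}_{g\mathscr A}(\widehat A_B,C)$$ between the set $\widehat{\mathscr R}(C)$ of $B$-representations of $A$ with coefficients in $C$ and the set of graded algebra homomorphisms $\widehat A_B\to C$. Consequently, for any commutative graded algebra $C$, there is a natural bijection $$\mathscr R(C)\stackrel{\simeq}{\longrightarrow}\mathrm{Hom}_{cg\mathscr A}(A_B,C),$$ where $\mathscr R$ is the restriction of $\widehat{\mathscr R}$ to commutative graded algebras.
   Context: $\mathbb{K}$ is a fixed commutative ring over which all objects are defined; ''graded'' means $\mathbb{Z}$-graded. $g\mathscr A$ is the category of graded algebras and graded algebra homomorphisms, $cg\mathscr A$ its full subcategory of commutative graded algebras ($xy=(-1)^{|x||y|}yx$ for homogeneous $x,y$). The tensor product of graded algebras has multiplication $(x\otimes b)(y\otimes c)=(-1)^{|b||y|}xy\otimes bc$; a graded bialgebra has comultiplication $\Delta$ and counit $\varepsilon$ that are graded algebra homomorphisms. Sweedler notation: $\Delta(x)=x'\otimes x''$ with homogeneous components. The algebra $\widehat A_B$ is the graded algebra generated by symbols $x_b$ ($x\in A$, $b\in B$), with $|x_b|=|x|+|b|$ for homogeneous $x,b$, subject to: bilinearity of $x_b$ in $(x,b)$; $(xy)_b=x_{b'}y_{b''}$; $(1_A)_b=\varepsilon_B(b)1$; $x_{bc}=x'_bx''_c$; $x_{(1_B)}=\varepsilon_A(x)1$. The algebra $A_B$ is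 the quotient of $\widehat A_B$ by the additional relations $x_by_c=(-1)^{|x_b||y_c|}y_cx_b$ for homogeneous $x,y\in A$, $b,c\in B$. For a graded algebra $C$ and $p\in\mathbb{Z}$ let $(H_B(C))^p$ be the module of linear maps $f:B\to C$ with $f(B^k)\subset C^{k+p}$ for all $k$, and $H_B(C)=\bigoplus_p(H_B(C))^p\subset\mathrm{Hom}(B,C)$. It is a graded algebra under convolution $(f*g)(b)=f(b')g(b'')$, with unit $\varepsilon_B\cdot1_C$. A $B$-representation of $A$ with coefficients in $C$ is a graded algebra homomorphism $u:A\to H_B(C)$ such that for all $x\in A$ and $b,c\in B$: $u(x)(1_B)=\varepsilon_A(x)1_C$ and $u(x)(bc)=u(x')(b)\cdot u(x'')(c)$. $\widehat{\mathscr R}(C)$ is the set of these; a graded algebra homomorphism $f:C\to C'$ induces $\widehat{\mathscr R}(f):\widehat{\mathscr R}(C)\to\widehat{\mathscr R}(C')$ sending $u$ to the map $x\mapsto f\circ u(x)$. Naturality is with respect to $C$. *)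

(* Defs.v *)
From HB Require Import structures.
From mathcomp Require Import all_boot all_order all_algebra.
From mathcomp Require Import generic_quotient.
From mathcomp Require Import boolp functions.
From mathcomp Require Import zify.

Set Implicit Arguments.
Unset Strict Implicit.
Unset Printing Implicit Defensive.

Import GRing.Theory.
Local Open Scope ring_scope.
Local Open Scope quotient_scope.

(* [H p] is meant to be the degree [p] part of [V] *)
Definition fin_sum_of (V : zmodType) (H : int -> V -> Prop) (x : V) : Prop :=
  exists s : seq (int * V),
    (forall q, q \in s -> H q.1 q.2) /\ x = \sum_(q <- s) q.2.

Definition independent (V : zmodType) (H : int -> V -> Prop) : Prop :=
  forall (s : seq int) (c : int -> V), uniq s -> (forall p, H p (c p)) ->
    \sum_(p <- s) c p = 0 -> forall p, p \in s -> c p = 0.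

(* A Z-graded unital algebra: the direct sum of the submodules [gr_homog p].
   MathComp's [algType] excludes the zero algebra, so the algebra structure is
   put directly on an [lmodType]; the ring notations are recovered below. *)
Record grAlgebra (K : comPzRingType) := GrAlgebra {
  gr_mod : lmodType K;
  gr_one : gr_mod;
  gr_mul : gr_mod -> gr_mod -> gr_mod;
  gr_mulA : associative gr_mul;
  gr_mul1r : left_id gr_one gr_mul;
  gr_mulr1 : right_id gr_one gr_mul;
  gr_mulPl : forall k x y z,
    gr_mul (k *: x + y) z = k *: gr_mul x z + gr_mul y z;
  gr_mulPr : forall k x y z,
    gr_mul x (k *: y + z) = k *: gr_mul x y + gr_mul x z;
  gr_homog : int -> gr_mod -> Prop;
  gr_homog0 : forall p, gr_homog p 0;
  gr_homogP : forall p k x y,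
    gr_homog p x -> gr_homog p y -> gr_homog p (k *: x + y);
  gr_homog_gen : forall x, fin_sum_of gr_homog x;
  gr_homog_indep : independent gr_homog;
  gr_homog1 : gr_homog 0 gr_one;
  gr_homogM : forall p q x y,
    gr_homog p x -> gr_homog q y -> gr_homog (p + q) (gr_mul x y)
}.

Definition gr_sort (K : comPzRingType) (A : grAlgebra K) : Type := gr_mod A.
Coercion gr_sort : grAlgebra >-> Sortclass.

Section GrAlgebraInstances.
Variables (K : comPzRingType) (A : grAlgebra K).

HB.instance Definition _ := GRing.Lmodule.copy (gr_sort A) (gr_mod A).

Let mulDl : left_distributive (@gr_mul K A) +%R.
Proof. by move=> x y z; rewrite -[x]scale1r gr_mulPl !scale1r. Qed.
Let mulDr : right_distributive (@gr_mul K A) +%R.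
Proof. by move=> x y z; rewrite -[y]scale1r gr_mulPr !scale1r. Qed.

HB.instance Definition _ := GRing.Zmodule_isPzRing.Build (gr_sort A)
  (@gr_mulA K A) (@gr_mul1r K A) (@gr_mulr1 K A) mulDl mulDr.

(* [homog p x] : [x] lies in the degree [p] part of [A] *)
Definition homog (p : int) (x : A) : Prop := gr_homog p x.

Lemma gr_scalerAl (k : K) (x y : A) : k *: (x * y) = (k *: x) * y.
Proof.
have e : (k *: x + 0) * y = k *: (x * y) + 0 * y by exact: gr_mulPl.
by rewrite addr0 mul0r addr0 in e.
Qed.
Lemma gr_scalerAr (k : K) (x y : A) : k *: (x * y) = x * (k *: y).
Proof.
have e : x * (k *: y + 0) = k *: (x * y) + x * 0 by exact: gr_mulPr.
by rewrite addr0 mulr0 addr0 in e.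
Qed.
Lemma homog0 p : homog p 0. Proof. exact: gr_homog0. Qed.
Lemma homogP p (k : K) x y : homog p x -> homog p y -> homog p (k *: x + y).
Proof. exact: gr_homogP. Qed.
Lemma homog1 : homog 0 1. Proof. exact: gr_homog1. Qed.
Lemma homogM p q x y : homog p x -> homog q y -> homog (p + q) (x * y).
Proof. exact: gr_homogM. Qed.
Lemma homog_gen x : fin_sum_of homog x. Proof. exact: gr_homog_gen. Qed.
Lemma homog_indep : independent homog. Proof. exact: gr_homog_indep. Qed.
Lemma homogZ p (k : K) x : homog p x -> homog p (k *: x).
Proof. by move=> h; rewrite -[_ *: _]addr0; apply: homogP => //; apply: homog0. Qed.
Lemma homogD p x y : homog p x -> homog p y -> homog p (x + y).
Proof. by move=> hx hy; rewrite -[x]scale1r; apply: homogP. Qed.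
Lemma homog_sum p (I : eqType) (r : seq I) (F : I -> A) :
  (forall i, i \in r -> homog p (F i)) -> homog p (\sum_(i <- r) F i).
Proof.
elim: r => [|i r IH] h; first by rewrite big_nil; apply: homog0.
rewrite big_cons; apply: homogD; first by apply: h; rewrite mem_head.
by apply: IH => j jr; apply: h; rewrite in_cons jr orbT.
Qed.
End GrAlgebraInstances.

Definition gsign (K : comPzRingType) (p q : int) : K := (-1) ^+ absz (p * q).
Arguments gsign {K} p q.

Lemma gsignDl (K : comPzRingType) p q r :
  gsign (p + q) r = gsign p r * gsign q r :> K.
Proof.
rewrite /gsign -exprD -signr_odd -[RHS]signr_odd; congr (_ ^+ (nat_of_bool _)).
by rewrite mulrDl oddD; lia.
Qed.
Lemma gsignDr (K : comPzRingType) p q r :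
  gsign r (p + q) = gsign r p * gsign r q :> K.
Proof. by rewrite /gsign ![r * _]mulrC; apply: gsignDl. Qed.
Lemma gsign0l (K : comPzRingType) p : gsign 0 p = 1 :> K.
Proof. by rewrite /gsign mul0r. Qed.
Lemma gsign0r (K : comPzRingType) p : gsign p 0 = 1 :> K.
Proof. by rewrite /gsign mulr0. Qed.

(* the objects of the full subcategory of commutative graded algebras *)
Record cgrAlgebra (K : comPzRingType) := CGrAlgebra {
  cgr_alg :> grAlgebra K;
  cgr_commute : forall p q (x y : cgr_alg), homog p x -> homog q y ->
    x * y = (gsign p q : K) *: (y * x)
}.

Record grHom (K : comPzRingType) (A C : grAlgebra K) := GrHom {
  grHom_fun :> {linear A -> C};
  grHom_monoid : monoid_morphism grHom_fun;
  grHom_homog : forall p x, homog p x -> homog p (grHom_fun x)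
}.

Section GrHom.
Variable K : comPzRingType.
Implicit Types A C D : grAlgebra K.

Lemma linear_ext (U V : lmodType K) (f g : {linear U -> V}) : f =1 g -> f = g.
Proof.
case: f g => f [[f1] [f2]] [g [[g1] [g2]]] /= /funext fg; subst g.
by congr (GRing.Linear.Pack (GRing.Linear.Class _ _));
   congr (_ _); apply: Prop_irrelevance.
Qed.

Lemma grHom_ext A C (f g : grHom A C) : f =1 g -> f = g.
Proof.
case: f g => f f1 f2 [g g1 g2] /= /linear_ext fg; subst g.
by congr GrHom; apply: Prop_irrelevance.
Qed.

Lemma grHomM A C (f : grHom A C) x y : f (x * y) = f x * f y.
Proof. by case: (grHom_monoid f). Qed.
Lemma grHom1 A C (f : grHom A C) : f 1 = 1.
Proof. by case: (grHom_monoid f). Qed.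

Definition grHom_of A C (f : A -> C) (fl : linear f) (fm : monoid_morphism f)
    (fh : forall p x, homog p x -> homog p (f x)) : grHom A C :=
  @GrHom _ A C (HB.pack f (GRing.isLinear.Build K A C *:%R f fl)) fm fh.

Lemma grHom_comp_lin A C D (f : grHom C D) (g : grHom A C) :
  linear (fun x => f (g x)).
Proof. by move=> k x y; rewrite !linearP. Qed.
Lemma grHom_comp_monoid A C D (f : grHom C D) (g : grHom A C) :
  monoid_morphism (fun x => f (g x)).
Proof. by split=> [|x y]; rewrite ?grHom1 ?grHomM. Qed.
Lemma grHom_comp_homog A C D (f : grHom C D) (g : grHom A C) p x :
  homog p x -> homog p (f (g x)).
Proof. by move=> h; do 2!apply: grHom_homog. Qed.

Definition grHom_comp A C D (f : grHom C D) (g : grHom A C) : grHom A D :=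
  grHom_of (grHom_comp_lin f g) (grHom_comp_monoid f g)
    (@grHom_comp_homog _ _ _ f g).
End GrHom.

Lemma independent_proj (V : zmodType) (H : int -> V -> Prop)
    (pr : int -> V -> V) :
  (forall p, {morph pr p : x y / x + y}) ->
  (forall p q x, H q x -> pr p x = if p == q then x else 0) ->
  independent H.
Proof.
move=> prD prH s c us Hc s0 p ps.
have pr0 q : pr q 0 = 0 by apply: (addrI (pr q 0)); rewrite -prD !addr0.
have : pr p (\sum_(q <- s) c q) = c p.
  rewrite (big_morph (pr p) (prD p) (pr0 p)) (bigD1_seq p) //= (prH _ p) // eqxx.
  rewrite big1 ?addr0 // => q /negPf qp; rewrite (prH _ q) //.
  by rewrite eq_sym qp.
by rewrite s0 pr0.
Qed.

Section FinSum.
Variables (V : zmodType) (H : int -> V -> Prop).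
Lemma fin_sum0 : fin_sum_of H 0.
Proof. by exists [::]; split=> //; rewrite big_nil. Qed.
Lemma fin_sum1 p x : H p x -> fin_sum_of H x.
Proof.
exists [:: (p, x)]; split=> [q|]; first by rewrite inE => /eqP ->.
by rewrite big_seq1.
Qed.
Lemma fin_sumD x y : fin_sum_of H x -> fin_sum_of H y -> fin_sum_of H (x + y).
Proof.
move=> [s [hs ->]] [t [ht ->]]; exists (s ++ t); split=> [q|].
  by rewrite mem_cat => /orP[/hs|/ht].
by rewrite big_cat.
Qed.
Lemma fin_sum_ind (P : V -> Prop) : P 0 ->
  (forall x y, P x -> P y -> P (x + y)) -> (forall p x, H p x -> P x) ->
  forall x, fin_sum_of H x -> P x.
Proof.
move=> P0 PD PH x [s [hs ->]]; elim: s hs => [|q s IH] hs.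
  by rewrite big_nil.
rewrite big_cons; apply: PD; first by apply/(PH q.1)/hs/mem_head.
by apply: IH => r rs; apply: hs; rewrite in_cons rs orbT.
Qed.
End FinSum.

Section Components.
Variables (K : comPzRingType) (A : grAlgebra K).
Implicit Types x y : A.

Definition is_decomp x (c : int -> A) (s : seq int) :=
  [/\ forall p, homog p (c p), uniq s, forall p, p \notin s -> c p = 0
    & x = \sum_(p <- s) c p].

Lemma is_decomp_widen x c s t : is_decomp x c s -> uniq t -> {subset s <= t} ->
  x = \sum_(p <- t) c p.
Proof.
move=> [_ us c0 ->] ut st.
rewrite [RHS](bigID (mem s)) /= [X in _ + X]big1; last by move=> p /c0.
rewrite addr0 -[RHS]big_filter; apply: perm_big; apply: uniq_perm => //.
  exact: filter_uniq.
by move=> p; rewrite mem_filter andb_idr //; apply: st.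
Qed.

Lemma is_decomp_uniq x c s c' s' : is_decomp x c s -> is_decomp x c' s' -> c = c'.
Proof.
move=> d d'; have [hc us c0 _] := d; have [hc' us' c0' _] := d'.
set t := undup (s ++ s').
have e : \sum_(p <- t) (c p - c' p) = 0.
  rewrite sumrB -(is_decomp_widen d) -?(is_decomp_widen d') ?undup_uniq ?subrr //.
    by move=> p; rewrite mem_undup mem_cat => ->; rewrite orbT.
  by move=> p; rewrite mem_undup mem_cat => ->.
apply/funext => p; have [pt|] := boolP (p \in t).
  apply/eqP; rewrite -subr_eq0; apply/eqP.
  apply: (@homog_indep _ A t (fun p => c p - c' p)) => //; first exact: undup_uniq.
  by move=> q; rewrite addrC -scaleN1r; apply: homogP.
by rewrite mem_undup mem_cat negb_or => /andP[/c0 -> /c0' ->].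
Qed.

Lemma decomp_ex x : exists cs : (int -> A) * seq int, is_decomp x cs.1 cs.2.
Proof.
have [l [hl ->]] := homog_gen x.
exists ((fun p => \sum_(q <- l | q.1 == p) q.2), undup (map fst l)); split=> /=.
- move=> p; rewrite -big_filter; apply: homog_sum => q.
  by rewrite mem_filter => /andP[/eqP <- /hl].
- exact: undup_uniq.
- move=> p; rewrite mem_undup => pl; rewrite big_seq_cond big1 // => q.
  move=> /andP[ql /eqP qp]; case/negP: pl; rewrite -qp.
  exact: map_f.
- rewrite (exchange_big_dep predT) //= big_seq [RHS]big_seq.
  apply: eq_bigr => q ql; rewrite big_mkcond (bigD1_seq q.1) ?undup_uniq //=.
    by rewrite eqxx big1 ?addr0 // => p /negPf; rewrite eq_sym => ->.
  by rewrite mem_undup map_f.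
Qed.

Definition decomp x := projT1 (cid (decomp_ex x)).
Lemma decompP x : is_decomp x (decomp x).1 (decomp x).2.
Proof. exact: projT2 (cid (decomp_ex x)). Qed.

(* the homogeneous components of [x], and the degrees where they may not vanish *)
Definition hcomp (p : int) x : A := (decomp x).1 p.
Definition hsupp x : seq int := (decomp x).2.

Lemma hcompE x c s : is_decomp x c s -> forall p, hcomp p x = c p.
Proof. by move=> d p; rewrite /hcomp (is_decomp_uniq (decompP x) d). Qed.
Lemma homog_hcomp p x : homog p (hcomp p x).
Proof. by case: (decompP x). Qed.
Lemma hsupp_uniq x : uniq (hsupp x).
Proof. by case: (decompP x). Qed.
Lemma hcomp_out p x : p \notin hsupp x -> hcomp p x = 0.
Proof. by case: (decompP x) => _ _ h _; apply: h. Qed.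
Lemma hcomp_sum x : \sum_(p <- hsupp x) hcomp p x = x.
Proof. by case: (decompP x). Qed.

Lemma hcomp_homog p q x : homog q x -> hcomp p x = if p == q then x else 0.
Proof.
move=> hx; rewrite (@hcompE x (fun p => if p == q then x else 0) [:: q]) //.
split=> // [r||].
- by case: eqP => [->//|_]; apply: homog0.
- by move=> r; rewrite inE => /negPf ->.
by rewrite big_seq1 eqxx.
Qed.

Lemma hcomp_linear p : linear (hcomp p).
Proof.
move=> k x y; set t := undup (hsupp x ++ hsupp y).
rewrite (@hcompE _ (fun p => k *: hcomp p x + hcomp p y) t) //.
split.
- by move=> q; apply: homogP; apply: homog_hcomp.
- exact: undup_uniq.
- move=> q; rewrite mem_undup mem_cat negb_or => /andP[/hcomp_out -> /hcomp_out ->].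
  by rewrite scaler0 addr0.
rewrite big_split -scaler_sumr; congr (_ *: _ + _).
  apply: (is_decomp_widen (decompP x)); first exact: undup_uniq.
  by move=> q qx; rewrite mem_undup mem_cat [q \in hsupp x]qx.
apply: (is_decomp_widen (decompP y)); first exact: undup_uniq.
by move=> q qx; rewrite mem_undup mem_cat [q \in hsupp y]qx orbT.
Qed.

Lemma homog_ind (P : A -> Prop) : P 0 ->
  (forall x y, P x -> P y -> P (x + y)) -> (forall p x, homog p x -> P x) ->
  forall x, P x.
Proof. by move=> P0 PD PH x; apply: fin_sum_ind (homog_gen x). Qed.

(* sum of a function of the homogeneous components of [x] and their degrees *)
Definition dsum (V : zmodType) (f : int -> A -> V) x : V :=
  \sum_(p <- hsupp x) f p (hcomp p x).

Lemma dsumE (V : zmodType) (f : int -> A -> V) x t :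
  (forall p, f p 0 = 0) -> uniq t -> {subset hsupp x <= t} ->
  dsum f x = \sum_(p <- t) f p (hcomp p x).
Proof.
move=> f0 ut st; rewrite [RHS](bigID (mem (hsupp x))) /= [X in _ + X]big1; last first.
  by move=> p /hcomp_out ->.
rewrite addr0 -[RHS]big_filter; apply: perm_big; apply: uniq_perm.
- exact: hsupp_uniq.
- exact: filter_uniq.
by move=> p; rewrite mem_filter andb_idr //; apply: st.
Qed.

Lemma linear0_of (U V : lmodType K) (f : U -> V) : linear f -> f 0 = 0.
Proof.
by move=> fl; have := fl (-1) 0 0; rewrite scaler0 addr0 scaleN1r addNr.
Qed.

Lemma dsum_linear (V : lmodType K) (f : int -> A -> V) :
  (forall p, linear (f p)) -> linear (dsum f).
Proof.
move=> fl k x y; have f0 p : f p 0 = 0 by apply: linear0_of.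
set t := undup (hsupp x ++ hsupp y ++ hsupp (k *: x + y)).
rewrite !(@dsumE _ f _ t) // ?undup_uniq //; first last.
- by move=> q qx; rewrite mem_undup !mem_cat qx ?orbT.
- by move=> q qx; rewrite mem_undup !mem_cat qx ?orbT.
- by move=> q qx; rewrite mem_undup !mem_cat qx ?orbT.
rewrite scaler_sumr -big_split; apply: eq_bigr => p _.
by rewrite hcomp_linear fl.
Qed.

Lemma dsum_homog (V : zmodType) (f : int -> A -> V) q x :
  (forall p, f p 0 = 0) -> homog q x -> dsum f x = f q x.
Proof.
move=> f0 hx; rewrite (@dsumE _ f x (undup (q :: hsupp x))) ?undup_uniq //; last first.
  by move=> p px; rewrite mem_undup in_cons px orbT.
rewrite (bigD1_seq q) ?undup_uniq ?mem_undup ?mem_head //=.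
rewrite (hcomp_homog _ hx) eqxx big1 ?addr0 // => p /negPf pq.
by rewrite (hcomp_homog _ hx) pq.
Qed.

Lemma dsum_param (V : lmodType K) (f g h : int -> A -> V) k x :
  (forall p z, h p z = k *: f p z + g p z) ->
  dsum h x = k *: dsum f x + dsum g x.
Proof.
by move=> e; rewrite /dsum scaler_sumr -big_split; apply: eq_bigr.
Qed.
End Components.

(* [M (x) N], generated as a commutative monoid by the pairs [(m, n)] *)
Inductive tens_eq (K : comPzRingType) (M N : lmodType K) :
    seq (M * N) -> seq (M * N) -> Prop :=
  | tens_refl s : tens_eq s s
  | tens_sym s t : tens_eq s t -> tens_eq t s
  | tens_trans s t u : tens_eq s t -> tens_eq t u -> tens_eq s u
  | tens_cat s s' t t' :
      tens_eq s s' -> tens_eq t t' -> tens_eq (s ++ t) (s' ++ t')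
  | tens_comm s t : tens_eq (s ++ t) (t ++ s)
  | tens_zero n : tens_eq [:: (0, n)] [::]
  | tens_addl m m' n : tens_eq [:: (m + m', n)] [:: (m, n); (m', n)]
  | tens_addr m n n' : tens_eq [:: (m, n + n')] [:: (m, n); (m, n')]
  | tens_scale k m n : tens_eq [:: (k *: m, n)] [:: (m, k *: n)].

Section Tensor.
Variables (K : comPzRingType) (M N : lmodType K).

Definition tens_rel : rel (seq (M * N)) := fun s t => `[< tens_eq s t >].

Let tens_rel_refl : reflexive tens_rel.
Proof. by move=> s; apply/asboolP; apply: tens_refl. Qed.
Let tens_rel_sym : symmetric tens_rel.
Proof. by move=> s t; apply/asboolP/asboolP; apply: tens_sym. Qed.
Let tens_rel_trans : transitive tens_rel.
Proof.
by move=> t s u /asboolP st /asboolP tu; apply/asboolP; apply: tens_trans tu.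
Qed.

Canonical tens_equiv := EquivRel tens_rel tens_rel_refl tens_rel_sym tens_rel_trans.

Definition tens : Type := {eq_quot tens_equiv}.
HB.instance Definition _ := Choice.copy tens {eq_quot tens_equiv}.

Definition tens_pi (s : seq (M * N)) : tens := \pi_({eq_quot tens_equiv}) s.
Definition tens_repr (t : tens) : seq (M * N) := repr (t : {eq_quot tens_equiv}).

Lemma tens_piK t : tens_pi (tens_repr t) = t.
Proof. exact: reprK. Qed.
Lemma tens_piP s t : tens_pi s = tens_pi t <-> tens_eq s t.
Proof.
split=> [/eqmodP/asboolP //|h].
by apply/eqmodP/asboolP.
Qed.
Lemma tens_reprK s : tens_eq (tens_repr (tens_pi s)) s.
Proof. by apply/tens_piP; rewrite tens_piK. Qed.

Definition pure (m : M) (n : N) : tens := tens_pi [:: (m, n)].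

Definition tens_scl (k : K) (s : seq (M * N)) := [seq (k *: p.1, p.2) | p <- s].

Lemma tens_scl_eq k s t : tens_eq s t -> tens_eq (tens_scl k s) (tens_scl k t).
Proof.
elim=> {s t} /=.
- by move=> s; apply: tens_refl.
- by move=> s t _; apply: tens_sym.
- by move=> s t u _ st _; apply: tens_trans st.
- by move=> s s' t t' _ h _ h'; rewrite /tens_scl !map_cat; apply: tens_cat.
- by move=> s t; rewrite /tens_scl !map_cat; apply: tens_comm.
- by move=> n; rewrite scaler0; apply: tens_zero.
- by move=> m m' n; rewrite scalerDr; apply: tens_addl.
- by move=> m n n'; apply: tens_addr.
- by move=> l m n; rewrite scalerA mulrC -scalerA; apply: tens_scale.
Qed.

Definition tadd (t u : tens) : tens := tens_pi (tens_repr t ++ tens_repr u).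
Definition tscl (k : K) (t : tens) : tens := tens_pi (tens_scl k (tens_repr t)).

Lemma taddE s t : tadd (tens_pi s) (tens_pi t) = tens_pi (s ++ t).
Proof. by apply/tens_piP/tens_cat; apply: tens_reprK. Qed.
Lemma tsclE k s : tscl k (tens_pi s) = tens_pi (tens_scl k s).
Proof. by apply/tens_piP/tens_scl_eq/tens_reprK. Qed.

Lemma tens_split (P : tens -> Prop) : (forall s, P (tens_pi s)) -> forall t, P t.
Proof. by move=> h t; rewrite -(tens_piK t). Qed.

Let taddA : associative tadd.
Proof.
elim/tens_split=> s; elim/tens_split=> t; elim/tens_split=> u.
by rewrite !taddE catA.
Qed.
Let taddC : commutative tadd.
Proof.
elim/tens_split=> s; elim/tens_split=> t; rewrite !taddE.
by apply/tens_piP/tens_comm.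
Qed.
Let tadd0 : left_id (tens_pi [::]) tadd.
Proof. by elim/tens_split=> s; rewrite taddE. Qed.
Let tscl0 t : tscl 0 t = tens_pi [::].
Proof.
elim/tens_split: t => s; rewrite tsclE; apply/tens_piP.
elim: s => [|[m n] s IH] /=; first exact: tens_refl.
rewrite scale0r; apply: (@tens_cat _ _ _ [:: (0, n)] [::]) => //.
exact: tens_zero.
Qed.
Let tsclDl t k l : tscl (k + l) t = tadd (tscl k t) (tscl l t).
Proof.
elim/tens_split: t => s; rewrite !tsclE.
elim: s => [|[m n] s IH] /=; first by rewrite tadd0.
rewrite -cat1s -taddE IH scalerDl.
have -> : tens_pi [:: (k *: m + l *: m, n)]
   = tadd (tens_pi [:: (k *: m, n)]) (tens_pi [:: (l *: m, n)]).
  by rewrite taddE; apply/tens_piP/tens_addl.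
rewrite -[in RHS]cat1s -[in RHS]taddE -[_ :: tens_scl l s]cat1s -[in RHS]taddE.
by rewrite -!taddA; congr tadd; rewrite !taddA; congr tadd; apply: taddC.
Qed.
Let taddN : left_inverse (tens_pi [::]) (tscl (-1)) tadd.
Proof.
move=> t; have {2}-> : t = tscl 1 t.
  elim/tens_split: t => s; rewrite tsclE; congr tens_pi.
  by rewrite /tens_scl -[LHS]map_id; apply: eq_map => -[m n]; rewrite scale1r.
by rewrite -tsclDl addNr tscl0.
Qed.

HB.instance Definition _ := GRing.isZmodule.Build tens taddA taddC tadd0 taddN.

Let tsclA (k l : K) t : tscl k (tscl l t) = tscl (k * l) t.
Proof.
elim/tens_split: t => s; rewrite !tsclE; congr tens_pi.
by rewrite /tens_scl -map_comp; apply: eq_map => p /=; rewrite scalerA.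
Qed.
Let tscl1 : left_id 1 tscl.
Proof.
elim/tens_split=> s; rewrite tsclE; congr tens_pi.
by rewrite /tens_scl -[RHS]map_id; apply: eq_map => -[m n]; rewrite scale1r.
Qed.
Lemma tens_piD s t : tens_pi s + tens_pi t = tens_pi (s ++ t).
Proof. exact: taddE. Qed.
Let tsclDr : right_distributive tscl +%R.
Proof.
move=> k; elim/tens_split=> s; elim/tens_split=> t.
by rewrite tens_piD !tsclE tens_piD /tens_scl map_cat.
Qed.
Let tsclDl' t : {morph tscl^~ t : k l / k + l}.
Proof. by move=> k l; apply: tsclDl. Qed.

HB.instance Definition _ :=
  GRing.Zmodule_isLmodule.Build K tens tsclA tscl1 tsclDr tsclDl'.

Lemma tens_piZ k s : k *: tens_pi s = tens_pi (tens_scl k s).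
Proof. exact: tsclE. Qed.

Lemma tens_pi_sum s : tens_pi s = \sum_(p <- s) pure p.1 p.2.
Proof.
elim: s => [|[m n] s IH]; first by rewrite big_nil.
by rewrite big_cons -IH; symmetry; apply: taddE.
Qed.

Definition bilin (V : lmodType K) (f : M -> N -> V) : Prop :=
  (forall n, linear (f^~ n)) /\ (forall m, linear (f m)).

Lemma bilinDl (V : lmodType K) (f : M -> N -> V) m m' n :
  bilin f -> f (m + m') n = f m n + f m' n.
Proof. by move=> [/(_ n 1 m m') fl _]; rewrite !scale1r in fl. Qed.
Lemma bilinDr (V : lmodType K) (f : M -> N -> V) m n n' :
  bilin f -> f m (n + n') = f m n + f m n'.
Proof. by move=> [_ /(_ m 1 n n') fr]; rewrite !scale1r in fr. Qed.

Lemma pure_bilin : bilin pure.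
Proof.
split=> [n k m m'|m k n n'].
  transitivity (tadd (pure (k *: m) n) (pure m' n)).
    by rewrite taddE; apply/tens_piP/tens_addl.
  by congr (_ + _); symmetry; apply: tsclE.
transitivity (tadd (pure m (k *: n)) (pure m n')).
  by rewrite taddE; apply/tens_piP/tens_addr.
congr (_ + _); symmetry; transitivity (pure (k *: m) n); first exact: tsclE.
by apply/tens_piP/tens_scale.
Qed.

Lemma tens_ind (P : tens -> Prop) : P 0 ->
  (forall t u, P t -> P u -> P (t + u)) -> (forall m n, P (pure m n)) ->
  forall t, P t.
Proof.
move=> P0 PD Pp; elim/tens_split=> s; rewrite tens_pi_sum.
by elim/big_rec: _ => // p t _; apply: PD.
Qed.

(* The linear map [tens -> V] induced by a bilinear [f], see [tlift_pure]:
   [tlift f t] is the sum of the [f t' t''], for t = sum of the t' (x) t'' *)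
Definition tlift (V : zmodType) (f : M -> N -> V) (t : tens) : V :=
  \sum_(p <- tens_repr t) f p.1 p.2.

Section Lift.
Variables (V : lmodType K) (f : M -> N -> V) (fB : bilin f).

Lemma tens_eq_sum s t : tens_eq s t ->
  \sum_(p <- s) f p.1 p.2 = \sum_(p <- t) f p.1 p.2.
Proof.
have [fl fr] := fB; elim=> {s t} //=.
- by move=> s t u _ -> _ ->.
- by move=> s s' t t' _ h _ h'; rewrite !big_cat /= h h'.
- by move=> s t; rewrite !big_cat /= addrC.
- by move=> n; rewrite big_seq1 big_nil /= (linear0_of (fl n)).
- move=> m m' n; rewrite [RHS]big_cons !big_seq1 /= -[m]scale1r.
  by rewrite (fl n) !scale1r.
- move=> m n n'; rewrite [RHS]big_cons !big_seq1 /= -[n]scale1r.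
  by rewrite (fr m) !scale1r.
- move=> k m n; rewrite !big_seq1 /=.
  have := fl n k m 0; rewrite addr0 (linear0_of (fl n)) addr0 => ->.
  by have := fr m k n 0; rewrite addr0 (linear0_of (fr m)) addr0 => ->.
Qed.

Lemma tliftE s : tlift f (tens_pi s) = \sum_(p <- s) f p.1 p.2.
Proof. exact/tens_eq_sum/tens_reprK. Qed.

Lemma tlift_pure m n : tlift f (pure m n) = f m n.
Proof. by rewrite tliftE big_seq1. Qed.

Lemma tlift_linear : linear (tlift f).
Proof.
move=> k; elim/tens_split=> s; elim/tens_split=> t.
rewrite tens_piZ tens_piD !tliftE.
rewrite big_cat /= scaler_sumr big_map /=; congr (_ + _).
apply: eq_bigr => -[m n] _ /=; have [fl _] := fB.
by have := fl n k m 0; rewrite addr0 (linear0_of (fl n)) addr0.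
Qed.

Lemma tlift0 : tlift f 0 = 0. Proof. exact/linear0_of/tlift_linear. Qed.
Lemma tliftD : {morph tlift f : t u / t + u}.
Proof. by move=> t u; rewrite -[t]scale1r tlift_linear !scale1r. Qed.
Lemma tlift_sum (s : seq (M * N)) :
  tlift f (\sum_(p <- s) pure p.1 p.2) = \sum_(p <- s) f p.1 p.2.
Proof. by rewrite -tens_pi_sum tliftE. Qed.
End Lift.

Lemma tlift_param (V : lmodType K) (f g h : M -> N -> V) k t :
  (forall m n, h m n = k *: f m n + g m n) ->
  tlift h t = k *: tlift f t + tlift g t.
Proof.
by move=> e; rewrite /tlift scaler_sumr -big_split; apply: eq_bigr.
Qed.

Lemma eq_tlift (V : zmodType) (f g : M -> N -> V) t :
  (forall m n, f m n = g m n) -> tlift f t = tlift g t.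
Proof. by move=> e; apply: eq_bigr. Qed.
End Tensor.

Arguments pure {K M N}.
Notation "m \ox n" := (pure m n) (at level 40, left associativity).

Section TensorAlgebra.
Variables (K : comPzRingType) (A B : grAlgebra K).

Local Notation T := (tens (gr_sort A) (gr_sort B)).

Lemma pureZDl k (x x' : A) (b : B) :
  (k *: x + x') \ox b = k *: (x \ox b) + x' \ox b.
Proof. exact: (pure_bilin _ _).1. Qed.
Lemma pureZDr k (x : A) (b b' : B) :
  x \ox (k *: b + b') = k *: (x \ox b) + x \ox b'.
Proof. exact: (pure_bilin _ _).2. Qed.
Lemma pureZl k (x : A) (b : B) : (k *: x) \ox b = k *: (x \ox b).
Proof. by have := pureZDl k x 0 b; rewrite addr0 (linear0_of ((pure_bilin _ _).1 b)) addr0. Qed.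
Lemma pureZr k (x : A) (b : B) : x \ox (k *: b) = k *: (x \ox b).
Proof. by have := pureZDr k x b 0; rewrite addr0 (linear0_of ((pure_bilin _ _).2 x)) addr0. Qed.

(* (x (x) b)(y (x) c), the sum over the homogeneous components b_i of b and y_j
   of y of the (-1)^(ij) x y_j (x) b_i c; see [pmul_homog] *)
Definition pmul (x : A) (b : B) (y : A) (c : B) : T :=
  dsum (fun i (b_i : B) =>
    dsum (fun j (y_j : A) => gsign i j *: ((x * y_j) \ox (b_i * c))) y) b.

Definition tmul (u v : T) : T :=
  tlift (fun x b => tlift (fun y c => pmul x b y c) v) u.

Let gr_mulDZl (C : grAlgebra K) k (x y z : C) : (k *: x + y) * z = k *: (x * z) + y * z.
Proof. by rewrite mulrDl gr_scalerAl. Qed.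
Let gr_mulDZr (C : grAlgebra K) k (x y z : C) : x * (k *: y + z) = k *: (x * y) + x * z.
Proof. by rewrite mulrDr gr_scalerAr. Qed.
Let scaler_lin (s k : K) (u v : T) : s *: (k *: u + v) = k *: (s *: u) + s *: v.
Proof. by rewrite scalerDr !scalerA mulrC. Qed.

Let pmul_inner_lin i (b : B) x c j :
  linear (fun y_j : A => gsign i j *: ((x * y_j) \ox (b * c)) : T).
Proof. by move=> k y y'; rewrite gr_mulDZr pureZDl scaler_lin. Qed.
Let pmul_outer_lin x y c i :
  linear (fun b_i : B =>
    dsum (fun j (y_j : A) => gsign i j *: ((x * y_j) \ox (b_i * c))) y : T).
Proof.
move=> k b b'; apply: dsum_param => j z.
by rewrite gr_mulDZl pureZDr scaler_lin.
Qed.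

Lemma pmul_lin1 b y c : linear (fun x => pmul x b y c).
Proof.
move=> k x x'; apply: dsum_param => i b_i; apply: dsum_param => j y_j.
by rewrite gr_mulDZl pureZDl scaler_lin.
Qed.
Lemma pmul_lin2 x y c : linear (fun b => pmul x b y c).
Proof. by apply: dsum_linear => i; apply: pmul_outer_lin. Qed.
Lemma pmul_lin3 x b c : linear (fun y => pmul x b y c).
Proof.
move=> k y y'; apply: dsum_param => i b_i.
by apply: (dsum_linear (fun j => @pmul_inner_lin i b_i x c j)).
Qed.
Lemma pmul_lin4 x b y : linear (fun c => pmul x b y c).
Proof.
move=> k c c'; apply: dsum_param => i b_i; apply: dsum_param => j y_j.
by rewrite gr_mulDZr pureZDr scaler_lin.
Qed.

Lemma pmul_bilin x b : bilin (fun y c => pmul x b y c).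
Proof. by split=> [c|y]; [apply: pmul_lin3|apply: pmul_lin4]. Qed.

Lemma tmul_bilin_out v : bilin (fun x b => tlift (fun y c => pmul x b y c) v).
Proof.
split=> [b|x] k z z'; apply: tlift_param => y c.
  exact: pmul_lin1.
exact: pmul_lin2.
Qed.

Lemma tmulPl k u u' v : tmul (k *: u + u') v = k *: tmul u v + tmul u' v.
Proof. exact: tlift_linear (tmul_bilin_out v) k u u'. Qed.
Lemma tmulPr k u v v' : tmul u (k *: v + v') = k *: tmul u v + tmul u v'.
Proof. by apply: tlift_param => x b; apply: tlift_linear (pmul_bilin x b) _ _ _. Qed.

Lemma tmul_pure x b y c : tmul (x \ox b) (y \ox c) = pmul x b y c.
Proof.
by rewrite /tmul (tlift_pure (tmul_bilin_out _)) (tlift_pure (pmul_bilin _ _)).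
Qed.

Lemma pmul_homog i j x b y c : homog i b -> homog j y ->
  pmul x b y c = gsign i j *: ((x * y) \ox (b * c)).
Proof.
move=> hb hy; rewrite /pmul (dsum_homog _ hb).
  by apply: dsum_homog hy => p; apply: linear0_of (pmul_inner_lin _ _ _ _ _).
by move=> p; apply: linear0_of (pmul_outer_lin _ _ _ _).
Qed.

Lemma tmul_homog i j x b y c : homog i b -> homog j y ->
  tmul (x \ox b) (y \ox c) = gsign i j *: ((x * y) \ox (b * c)).
Proof. by move=> hb hy; rewrite tmul_pure; apply: pmul_homog. Qed.

Inductive tens_homog : int -> T -> Prop :=
  | tens_homog0 p : tens_homog p 0
  | tens_homogP p k u v :
      tens_homog p u -> tens_homog p v -> tens_homog p (k *: u + v)
  | tens_homog_pure p q x b :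
      homog p x -> homog q b -> tens_homog (p + q) (x \ox b).

Let tmul0l v : tmul 0 v = 0.
Proof. exact: (linear0_of (fun k u u' => tmulPl k u u' v)). Qed.
Let tmul0r u : tmul u 0 = 0.
Proof. exact: (linear0_of (fun k v v' => tmulPr k u v v')). Qed.
Let tmulZl k u v : tmul (k *: u) v = k *: tmul u v.
Proof. by rewrite -[k *: u]addr0 tmulPl tmul0l addr0. Qed.
Let tmulZr k u v : tmul u (k *: v) = k *: tmul u v.
Proof. by rewrite -[k *: v]addr0 tmulPr tmul0r addr0. Qed.
Let tmulDl u u' v : tmul (u + u') v = tmul u v + tmul u' v.
Proof. by rewrite -[u]scale1r tmulPl !scale1r. Qed.
Let tmulDr u v v' : tmul u (v + v') = tmul u v + tmul u v'.
Proof. by rewrite -[v]scale1r tmulPr !scale1r. Qed.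

Lemma tens_homog_ind' (P : T -> Prop) : P 0 ->
  (forall u v, P u -> P v -> P (u + v)) ->
  (forall i j x b, homog i x -> homog j b -> P (x \ox b)) -> forall u, P u.
Proof.
move=> P0 PD Ph; elim/tens_ind => // x b.
elim/homog_ind: x b => [b|x y hx hy b|i x hx].
- by rewrite (linear0_of ((pure_bilin _ _).1 b)).
- by rewrite -[x]scale1r pureZDl !scale1r; apply: PD.
elim/homog_ind => [|b c hb hc|j b hb]; last exact: Ph hx hb.
- by rewrite (linear0_of ((pure_bilin _ _).2 x)).
- by rewrite -[b]scale1r pureZDr !scale1r; apply: PD.
Qed.

Lemma tmulA : associative tmul.
Proof.
elim/tens_homog_ind' => [v w|u u' hu hu' v w|i j x b hx hb].
- by rewrite !tmul0l.
- by rewrite !tmulDl hu hu'.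
elim/tens_homog_ind' => [w|v v' hv hv' w|k l y c hy hc].
- by rewrite !(tmul0l, tmul0r).
- by rewrite !(tmulDl, tmulDr) hv hv'.
elim/tens_homog_ind' => [|w w' hw hw'|m n z d hz hd].
- by rewrite !tmul0r.
- by rewrite !tmulDr hw hw'.
rewrite (tmul_homog _ _ hc hz) (tmul_homog _ _ hb hy) tmulZl tmulZr.
rewrite (tmul_homog _ _ hb (homogM hy hz)) (tmul_homog _ _ (homogM hb hc) hz).
rewrite !scalerA !mulrA gsignDr gsignDl; congr (_ *: _).
by rewrite [LHS]mulrC -!mulrA.
Qed.

Lemma tmul1l : left_id ((1 : A) \ox (1 : B)) tmul.
Proof.
elim/tens_homog_ind' => [|u v hu hv|i j x b hx hb].
- by rewrite tmul0r.
- by rewrite tmulDr hu hv.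
by rewrite (tmul_homog _ _ (homog1 _) hx) gsign0l scale1r !mul1r.
Qed.
Lemma tmul1r : right_id ((1 : A) \ox (1 : B)) tmul.
Proof.
elim/tens_homog_ind' => [|u v hu hv|i j x b hx hb].
- by rewrite tmul0l.
- by rewrite tmulDl hu hv.
by rewrite (tmul_homog _ _ hb (homog1 _)) gsign0r scale1r !mulr1.
Qed.

Lemma tens_homog_gen u : fin_sum_of tens_homog u.
Proof.
elim/tens_homog_ind': u => [|u v|i j x b hx hb].
- exact: fin_sum0.
- exact: fin_sumD.
- by apply: (@fin_sum1 _ _ (i + j)); apply: tens_homog_pure.
Qed.

Let tproj_fun (n : int) (x : A) (b : B) : T :=
  dsum (fun i (x_i : A) =>
    dsum (fun j (b_j : B) => if i + j == n then x_i \ox b_j else 0) b) x.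

Let tproj_lin1 (n i j : int) (x : A) : linear (fun b : B => if i + j == n then x \ox b else 0 : T).
Proof.
by move=> k b b'; case: ifP => _; rewrite ?scaler0 ?addr0 // pureZDr.
Qed.
Let tproj_lin2 (n i : int) (b : B) :
  linear (fun x : A => dsum (fun j (b_j : B) => if i + j == n then x \ox b_j else 0 : T) b).
Proof.
move=> k x x'; apply: dsum_param => j b_j.
by case: ifP => _; rewrite ?scaler0 ?addr0 // pureZDl.
Qed.
Let tproj_bilin n : bilin (tproj_fun n).
Proof.
split=> [b|x]; first by apply: dsum_linear => i; apply: tproj_lin2.
by move=> k b b'; apply: dsum_param => i x_i; apply: dsum_linear.
Qed.

Lemma tens_homog_indep : independent tens_homog.
Proof.
apply: (@independent_proj _ _ (fun n => tlift (tproj_fun n))) => [n u v|n q u hu].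
  exact: tliftD (tproj_bilin n) u v.
elim: hu n => {q u} [p n|p k u v _ hu _ hv n|p q x b hx hb n].
- by rewrite (tlift0 (tproj_bilin n)) if_same.
- rewrite (tlift_linear (tproj_bilin n)) hu hv.
  by case: ifP => _ //; rewrite scaler0 addr0.
rewrite (tlift_pure (tproj_bilin n)) /tproj_fun (dsum_homog _ hx); last first.
  by move=> i; apply: linear0_of (tproj_lin2 _ _ _).
rewrite (dsum_homog _ hb); first by rewrite eq_sym.
by move=> j; apply: linear0_of (tproj_lin1 _ _ _ _).
Qed.

Lemma tens_homogM p q u v :
  tens_homog p u -> tens_homog q v -> tens_homog (p + q) (tmul u v).
Proof.
move=> hu; elim: hu q v => {p u} [p q v _|p k u u' _ hu _ hu' q v hv|].
- by rewrite tmul0l; apply: tens_homog0.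
- by rewrite tmulPl; apply: tens_homogP; [apply: hu|apply: hu'].
move=> i j x b hx hb q v; elim=> {q v} [q|q k v v' _ hv _ hv'|i' j' y c hy hc].
- by rewrite tmul0r; apply: tens_homog0.
- by rewrite tmulPr; apply: tens_homogP.
rewrite (tmul_homog _ _ hb hy) -[_ *: _]addr0.
apply: tens_homogP; last exact: tens_homog0.
by rewrite addrACA; apply: tens_homog_pure; apply: homogM.
Qed.

Lemma tens_homog_1 : tens_homog 0 ((1 : A) \ox (1 : B)).
Proof. by rewrite -[0]addr0; apply: tens_homog_pure; apply: homog1. Qed.

Definition gr_tens : grAlgebra K :=
  GrAlgebra tmulA tmul1l tmul1r tmulPl tmulPr tens_homog0 tens_homogP
    tens_homog_gen tens_homog_indep tens_homog_1 tens_homogM.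
End TensorAlgebra.

Section BaseRing.
Variable K : comPzRingType.

(* the base ring, concentrated in degree 0 *)
Definition base_homog (p : int) (x : K^o) : Prop := p = 0 \/ x = 0.

Let baseA : associative (fun x y : K^o => x * y : K^o).
Proof. exact: mulrA. Qed.
Let base1l : left_id (1 : K^o) (fun x y : K^o => x * y : K^o).
Proof. exact: mul1r. Qed.
Let base1r : right_id (1 : K^o) (fun x y : K^o => x * y : K^o).
Proof. exact: mulr1. Qed.
Let basePl (k : K) (x y z : K^o) :
  (k *: x + y) * z = k *: (x * z : K^o) + y * z :> K^o.
Proof. by rewrite mulrDl /GRing.scale /= mulrA. Qed.
Let basePr (k : K) (x y z : K^o) :
  x * (k *: y + z) = k *: (x * y : K^o) + x * z :> K^o.
Proof. by rewrite mulrDr /GRing.scale /= mulrCA. Qed.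
Let base_homog0 p : base_homog p 0. Proof. by right. Qed.
Let base_homogP p (k : K) x y :
  base_homog p x -> base_homog p y -> base_homog p (k *: x + y).
Proof.
by move=> [->|->] [|->] => [||->|]; [left|left|left|right; rewrite scaler0 addr0].
Qed.
Let base_homog_gen x : fin_sum_of base_homog x.
Proof. by apply: (@fin_sum1 _ _ 0); left. Qed.
Let base_homog_indep : independent base_homog.
Proof.
apply: (@independent_proj _ _ (fun p x => if p == 0 then x else 0)).
  by move=> p x y; case: ifP; rewrite ?addr0.
move=> p q x [->|->]; first by [].
by rewrite !if_same.
Qed.
Let base_homog1 : base_homog 0 1. Proof. by left. Qed.
Let base_homogM p q x y :
  base_homog p x -> base_homog q y -> base_homog (p + q) (x * y).
Proof.
move=> [->|->]; last by right; rewrite mul0r.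
by move=> [->|->]; [left; rewrite addr0|right; rewrite mulr0].
Qed.

Definition gr_base : grAlgebra K :=
  GrAlgebra baseA base1l base1r basePl basePr base_homog0 base_homogP
    base_homog_gen base_homog_indep base_homog1 base_homogM.
End BaseRing.

(* The coassociativity is stated in A (x) (A (x) A), through the Sweedler sums
   [tlift]; the comultiplication is applied again to the first factor in the
   left-hand side, and to the second one in the right-hand side. *)
Record grBialgebra (K : comPzRingType) := GrBialgebra {
  bi_alg :> grAlgebra K;
  comul : grHom bi_alg (gr_tens bi_alg bi_alg);
  counit : grHom bi_alg (gr_base K);
  comul_coassoc : forall x,
    tlift (fun x' x'' => tlift (fun y' y'' => y' \ox (y'' \ox x'')) (comul x'))
      (comul x)
    = tlift (fun x' x'' => x' \ox comul x'') (comul x);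
  comul_counitl : forall x,
    tlift (fun x' x'' => (counit x' : K) *: x'') (comul x) = x;
  comul_counitr : forall x,
    tlift (fun x' x'' => (counit x'' : K) *: x') (comul x) = x
}.

Section ConvolutionAlgebra.
Variables (K : comPzRingType) (B : grBialgebra K) (C : grAlgebra K).

Definition hom_homog (p : int) (f : B -> C) : Prop :=
  linear f /\ forall k b, homog k b -> homog (k + p) (f b).

(* the value at b is the Sweedler sum of the f(b')g(b'') *)
Definition convol (f g : B -> C) : B -> C :=
  fun b => tlift (fun b' b'' => f b' * g b'') (comul B b).

Definition convol1 : B -> C := fun b => (counit B b : K) *: (1 : C).

Definition homB_pred : {pred B -> C} := fun f => `[< fin_sum_of hom_homog f >].

(* the sum of the modules of linear maps B -> C of degree p, for p in Z *)
Record homB := HomB { homB_fun :> B -> C; homB_mem : homB_pred homB_fun }.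

HB.instance Definition _ := [isSub for homB_fun].
HB.instance Definition _ := [Choice of homB by <:].

Lemma hom_homog0 p : hom_homog p 0.
Proof.
by split=> [k x y|k b _]; [rewrite scaler0 addr0|apply: homog0].
Qed.
Lemma hom_homogP p (k : K) f g :
  hom_homog p f -> hom_homog p g -> hom_homog p (k *: f + g).
Proof.
move=> [fl fh] [gl gh]; split=> [l x y|q b hb]; last first.
  by apply: homogP; [apply: fh|apply: gh].
change (k *: f (l *: x + y) + g (l *: x + y)
  = l *: (k *: f x + g x) + (k *: f y + g y)).
by rewrite fl gl !scalerDr !scalerA [l * k]mulrC addrACA.
Qed.

Lemma homB_pred_closed : GRing.subsemimod_closed homB_pred.
Proof.
split; last first.
  move=> k f /asboolP [s [hs ->]]; apply/asboolP; rewrite scaler_sumr.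
  exists [seq (q.1, k *: q.2) | q <- s]; rewrite big_map; split=> //= q.
  move=> /mapP[r rs ->] /=; rewrite -[_ *: _]addr0.
  by apply: hom_homogP; [apply: hs|apply: hom_homog0].
split; first by apply/asboolP/fin_sum0.
by move=> f g /asboolP hf /asboolP hg; apply/asboolP/fin_sumD.
Qed.
HB.instance Definition _ := GRing.isSubmodClosed.Build K (B -> C) homB_pred
  homB_pred_closed.
HB.instance Definition _ := [SubChoice_isSubLmodule of homB by <:].

Lemma homB_ext (f g : homB) : homB_fun f =1 homB_fun g -> f = g.
Proof. by move=> /funext e; apply: val_inj. Qed.

Lemma homBP (f : homB) : fin_sum_of hom_homog f.
Proof. exact: (asboolW (homB_mem f)). Qed.

Lemma fin_sum_linear (f : B -> C) : fin_sum_of hom_homog f -> linear f.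
Proof.
elim/fin_sum_ind => {f} [k x y|f g fl gl k x y|p f []//].
  by rewrite scaler0 addr0.
change (f (k *: x + y) + g (k *: x + y) = k *: (f x + g x) + (f y + g y)).
by rewrite fl gl scalerDr addrACA.
Qed.
Lemma homB_linear (f : homB) : linear f.
Proof. exact/fin_sum_linear/homBP. Qed.

Let mul_bilin (f g : B -> C) : linear f -> linear g ->
  bilin (fun b' b'' => f b' * g b'').
Proof.
move=> fl gl; split=> [b|b] k x y; rewrite /= ?fl ?gl.
  by rewrite mulrDl gr_scalerAl.
by rewrite mulrDr gr_scalerAr.
Qed.

Lemma convol_linear (f g : B -> C) : linear f -> linear g -> linear (convol f g).
Proof.
by move=> fl gl k x y; rewrite /convol linearP (tlift_linear (mul_bilin fl gl)).
Qed.

Lemma convolPl (k : K) (f f' g : B -> C) :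
  convol (k *: f + f') g = k *: convol f g + convol f' g.
Proof.
apply/funext => b; apply: tlift_param => b' b''.
by rewrite gr_scalerAl -mulrDl.
Qed.
Lemma convolPr (k : K) (f g g' : B -> C) :
  convol f (k *: g + g') = k *: convol f g + convol f g'.
Proof.
apply/funext => b; apply: tlift_param => b' b''.
by rewrite gr_scalerAr -mulrDr.
Qed.

Lemma convol_homog p q f g :
  hom_homog p f -> hom_homog q g -> hom_homog (p + q) (convol f g).
Proof.
move=> [fl fh] [gl gh]; split; first exact: convol_linear.
move=> k b /(grHom_homog (comul B)) hb; rewrite /convol.
elim: hb => {k b} [k|k l u v _ hu _ hv|i j b' b'' hb' hb''].
- by rewrite (tlift0 (mul_bilin fl gl)); apply: homog0.
- by rewrite (tlift_linear (mul_bilin fl gl)); apply: homogP.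
rewrite (tlift_pure (mul_bilin fl gl)) addrACA.
by apply: homogM; [apply: fh|apply: gh].
Qed.

Lemma convol1_homog : hom_homog 0 convol1.
Proof.
split=> [k x y|k b /(grHom_homog (counit B)) [->|e]].
- by rewrite /convol1 linearP scalerDl scalerA.
- by rewrite addr0; apply/homogZ/homog1.
by rewrite /convol1 e scale0r; apply: homog0.
Qed.

Let convol0l g : convol 0 g = 0.
Proof. exact: (linear0_of (fun k f f' => convolPl k f f' g)). Qed.
Let convol0r f : convol f 0 = 0.
Proof. exact: (linear0_of (fun k g g' => convolPr k f g g')). Qed.
Let convolDl f f' g : convol (f + f') g = convol f g + convol f' g.
Proof. by rewrite -[f]scale1r convolPl !scale1r. Qed.
Let convolDr f g g' : convol f (g + g') = convol f g + convol f g'.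
Proof. by rewrite -[g]scale1r convolPr !scale1r. Qed.

Lemma convol_mem (f g : homB) : homB_pred (convol f g).
Proof.
apply/asboolP; elim/fin_sum_ind: {f}(f : B -> C) / (homBP f) => [|f f' hf hf'|p f hf].
- by rewrite convol0l; apply: fin_sum0.
- by rewrite convolDl; apply: fin_sumD.
elim/fin_sum_ind: {g}(g : B -> C) / (homBP g) => [|g g' hg hg'|q g hg].
- by rewrite convol0r; apply: fin_sum0.
- by rewrite convolDr; apply: fin_sumD.
by apply: (@fin_sum1 _ _ (p + q)); apply: convol_homog.
Qed.
Lemma convol1_mem : homB_pred convol1.
Proof. by apply/asboolP/(@fin_sum1 _ _ 0)/convol1_homog. Qed.

Definition homB_mul (f g : homB) : homB := HomB (convol_mem f g).
Definition homB_one : homB := HomB convol1_mem.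
Definition homB_homog (p : int) (f : homB) : Prop := hom_homog p f.

Lemma tlift_comp (M N U V : lmodType K) (L : U -> V) (f : M -> N -> U) t :
  linear L -> L (tlift f t) = tlift (fun m n => L (f m n)) t.
Proof.
move=> Ll; have LD : {morph L : x y / x + y}.
  by move=> x y; rewrite -[x]scale1r Ll !scale1r.
exact: (big_morph L LD (linear0_of Ll)).
Qed.

Lemma convolA (f g h : B -> C) : linear f -> linear g -> linear h ->
  convol f (convol g h) = convol (convol f g) h.
Proof.
move=> fl gl hl; apply/funext => b.
have ghB := mul_bilin gl hl.
pose Psi (y : B) (t : tens B B) : C :=
  f y * tlift (fun z w => g z * h w) t.
have PsiB : bilin Psi.
  apply: (conj _ _) => [t|y] k z z'; rewrite /Psi.
    by rewrite fl mulrDl gr_scalerAl.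
  by rewrite (tlift_linear ghB) mulrDr gr_scalerAr.
have := congr1 (tlift Psi) (comul_coassoc b).
rewrite !(tlift_comp _ _ (tlift_linear PsiB)) => e.
transitivity (tlift (fun x' x'' => tlift Psi (x' \ox (comul B x'' : tens B B))) (comul B b)).
  by apply: eq_tlift => x' x''; rewrite (tlift_pure PsiB).
rewrite -e; apply: eq_tlift => x' x''.
rewrite (tlift_comp _ _ (tlift_linear PsiB)).
have hl' : linear (fun c : C => c * h x'').
  by move=> k c c'; rewrite mulrDl gr_scalerAl.
rewrite /convol [RHS](tlift_comp _ _ hl'); apply: eq_tlift => y' y''.
by rewrite (tlift_pure PsiB) /Psi (tlift_pure ghB) mulrA.
Qed.

Let homB_mulA : associative homB_mul.
Proof.
move=> f g h; apply: val_inj; apply: convolA; exact: homB_linear.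
Qed.
Let homB_mul1l : left_id homB_one homB_mul.
Proof.
move=> f; apply: homB_ext => b /=; rewrite -[in RHS](comul_counitl b).
rewrite (tlift_comp _ _ (homB_linear f)); apply: eq_tlift => b' b''.
rewrite -gr_scalerAl mul1r.
have := homB_linear f (counit B b') b'' 0.
by rewrite (linear0_of (homB_linear f)) !addr0.
Qed.
Let homB_mul1r : right_id homB_one homB_mul.
Proof.
move=> f; apply: homB_ext => b /=; rewrite -[in RHS](comul_counitr b).
rewrite (tlift_comp _ _ (homB_linear f)); apply: eq_tlift => b' b''.
rewrite -gr_scalerAr mulr1.
have := homB_linear f (counit B b'') b' 0.
by rewrite (linear0_of (homB_linear f)) !addr0.
Qed.
Let homB_mulPl k f f' g :
  homB_mul (k *: f + f') g = k *: homB_mul f g + homB_mul f' g.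
Proof. by apply: val_inj; apply: convolPl. Qed.
Let homB_mulPr k f g g' :
  homB_mul f (k *: g + g') = k *: homB_mul f g + homB_mul f g'.
Proof. by apply: val_inj; apply: convolPr. Qed.
Let homB_homog0 p : homB_homog p 0.
Proof. exact: hom_homog0. Qed.
Let homB_homogP p k f g :
  homB_homog p f -> homB_homog p g -> homB_homog p (k *: f + g).
Proof. exact: hom_homogP. Qed.
Let homB_gen f : fin_sum_of homB_homog f.
Proof.
have : exists2 F : homB, F = f :> (B -> C) & fin_sum_of homB_homog F.
  elim/fin_sum_ind: {f}(f : B -> C) / (homBP f) => [|f g|p f hf].
  - by exists 0 => //; apply: fin_sum0.
  - by move=> [F <- hF] [G <- hG]; exists (F + G) => //; apply: fin_sumD.
  have hf' : homB_pred f by apply/asboolP/fin_sum1/hf.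
  by exists (HomB hf') => //; apply: (@fin_sum1 _ _ p).
by case=> F /val_inj ->.
Qed.

Let homB_indep : independent homB_homog.
Proof.
move=> s c us hc s0 p ps; apply: homB_ext.
elim/homog_ind => [|x y hx hy|k b hb].
- exact: (linear0_of (homB_linear (c p))).
- have e := homB_linear (c p) 1 x y; rewrite !scale1r in e.
  by rewrite e hx hy; apply: addr0.
have uk : uniq [seq k + q | q <- s].
  by rewrite map_inj_uniq //; apply: addrI.
have hk q : homog q (c (q - k) b).
  by have [_ /(_ k b hb)] := hc (q - k); rewrite addrC subrK.
have := @homog_indep _ _ _ _ uk hk _ (k + p) (map_f _ ps).
rewrite [k + p - k]addrC addKr; apply; rewrite big_map.
transitivity (homB_fun (\sum_(q <- s) c q) b); last by rewrite s0.
elim: {us s0 ps uk} s => [|q s IH]; first by rewrite !big_nil.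
by rewrite !big_cons IH [k + q - k]addrC addKr.
Qed.
Let homB_homog1 : homB_homog 0 homB_one.
Proof. exact: convol1_homog. Qed.
Let homB_homogM p q f g :
  homB_homog p f -> homB_homog q g -> homB_homog (p + q) (homB_mul f g).
Proof. exact: convol_homog. Qed.

(* the graded algebra H_B(C) *)
Definition gr_homB : grAlgebra K :=
  GrAlgebra homB_mulA homB_mul1l homB_mul1r homB_mulPl homB_mulPr homB_homog0
    homB_homogP homB_gen homB_indep homB_homog1 homB_homogM.
End ConvolutionAlgebra.

Section HomBMap.
Variables (K : comPzRingType) (B : grBialgebra K) (C C' : grAlgebra K).
Variable f : grHom C C'.

Lemma homB_map_mem (g : homB B C) : homB_pred (fun b => f (g b)).
Proof.
apply/asboolP; elim/fin_sum_ind: {g}(homB_fun g) / (homBP g) => [|g h|p g [gl gh]].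
- rewrite (_ : (fun b => f ((0 : B -> C) b)) = 0); first exact: fin_sum0.
  by apply/funext => b; apply: linear0.
- rewrite (_ : (fun b => f ((g + h) b)) = (fun b => f (g b)) + (fun b => f (h b))).
    exact: fin_sumD.
  by apply/funext => b; apply: raddfD.
apply: (@fin_sum1 _ _ p); split=> [k x y|k b hb]; first by rewrite gl linearP.
by apply: grHom_homog; apply: gh.
Qed.

Definition homB_map_fun (g : gr_homB B C) : gr_homB B C' := HomB (homB_map_mem g).

Lemma homB_map_linear : linear homB_map_fun.
Proof. by move=> k g h; apply: homB_ext => b; apply: linearP. Qed.
Lemma homB_map_monoid : monoid_morphism homB_map_fun.
Proof.
split=> [|g h]; apply: homB_ext => b.
  by rewrite -[LHS]/(f ((counit B b : K) *: (1 : C))) linearZ /= grHom1.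
have fl : linear f by move=> k x y; rewrite linearP.
rewrite -[LHS]/(f (convol _ _ b)) /convol (tlift_comp _ _ fl).
by apply: eq_tlift => b' b''; rewrite grHomM.
Qed.
Lemma homB_map_homog p g : homog p g -> homog p (homB_map_fun g).
Proof.
move=> [gl gh]; split=> [k x y|k b hb]; first by rewrite /= gl linearP.
by apply: grHom_homog; apply: gh.
Qed.
Definition homB_map : grHom (gr_homB B C) (gr_homB B C') :=
  grHom_of homB_map_linear homB_map_monoid homB_map_homog.
End HomBMap.

Record bRep (K : comPzRingType) (A B : grBialgebra K) (C : grAlgebra K) := BRep {
  bRep_hom :> grHom A (gr_homB B C);
  bRep_unit : forall x : A,
    homB_fun (bRep_hom x) 1 = (counit A x : K) *: (1 : C);
  bRep_mul : forall (x : A) (b c : B),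
    homB_fun (bRep_hom x) (b * c)
    = tlift (fun x' x'' => homB_fun (bRep_hom x') b * homB_fun (bRep_hom x'') c)
        (comul A x)
}.

Section BRepMap.
Variables (K : comPzRingType) (A B : grBialgebra K) (C C' : grAlgebra K).

Lemma bRep_ext (u v : bRep A B C) :
  (forall x b, homB_fun (u x) b = homB_fun (v x) b) -> u = v.
Proof.
case: u v => u u1 uM [v v1 vM] /= e.
have {}e : u = v by apply: grHom_ext => x; apply: homB_ext => b; apply: e.
by subst v; congr BRep; apply: Prop_irrelevance.
Qed.

Variables (f : grHom C C') (u : bRep A B C).
Let fu : grHom A (gr_homB B C') := grHom_comp (homB_map B f) u.

Let fu_unit (x : A) : homB_fun (fu x) 1 = (counit A x : K) *: (1 : C').
Proof. by rewrite -[LHS]/(f (homB_fun (u x) 1)) bRep_unit linearZ /= grHom1. Qed.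
Let fu_mul (x : A) (b c : B) : homB_fun (fu x) (b * c)
  = tlift (fun x' x'' => homB_fun (fu x') b * homB_fun (fu x'') c) (comul A x).
Proof.
have fl : linear f by move=> k y z; rewrite linearP.
rewrite -[LHS]/(f (homB_fun (u x) (b * c))) bRep_mul (tlift_comp _ _ fl).
by apply: eq_tlift => x' x''; rewrite grHomM.
Qed.

Definition bRep_map : bRep A B C' := BRep fu_unit fu_mul.
End BRepMap.

(* noncommutative polynomial expressions in the symbols [x_b] *)
Inductive hat_term (K : Type) (A B : Type) : Type :=
  | HGen of A & B
  | HConst of K
  | HAdd of hat_term K A B & hat_term K A B
  | HMul of hat_term K A B & hat_term K A B.
Arguments HGen {K A B} x b.
Arguments HConst {K A B} k.
Arguments HAdd {K A B} s t.
Arguments HMul {K A B} s t.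

Definition HSum (K : comPzRingType) (A B : Type) (s : seq (hat_term K A B)) :=
  foldr HAdd (HConst 0) s.

(* The congruence defining [hat A B]: first the laws of a [K]-algebra, then the
   relations between the symbols [x_b]; [s] runs over all the expressions of
   the comultiplication as a finite sum of pure tensors *)
Inductive hat_eq (K : comPzRingType) (A B : grBialgebra K) :
    hat_term K A B -> hat_term K A B -> Prop :=
  | hat_refl s : hat_eq s s
  | hat_sym s t : hat_eq s t -> hat_eq t s
  | hat_trans s t u : hat_eq s t -> hat_eq t u -> hat_eq s u
  | hat_add s s' t t' :
      hat_eq s s' -> hat_eq t t' -> hat_eq (HAdd s t) (HAdd s' t')
  | hat_mul s s' t t' :
      hat_eq s s' -> hat_eq t t' -> hat_eq (HMul s t) (HMul s' t')
  | hat_addA s t u : hat_eq (HAdd s (HAdd t u)) (HAdd (HAdd s t) u)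
  | hat_addC s t : hat_eq (HAdd s t) (HAdd t s)
  | hat_add0 s : hat_eq (HAdd (HConst 0) s) s
  | hat_mulA s t u : hat_eq (HMul s (HMul t u)) (HMul (HMul s t) u)
  | hat_mul1 s : hat_eq (HMul (HConst 1) s) s
  | hat_mul0 s : hat_eq (HMul (HConst 0) s) (HConst 0)
  | hat_mulDl s t u : hat_eq (HMul (HAdd s t) u) (HAdd (HMul s u) (HMul t u))
  | hat_mulDr s t u : hat_eq (HMul s (HAdd t u)) (HAdd (HMul s t) (HMul s u))
  | hat_constD k l : hat_eq (HConst (k + l)) (HAdd (HConst k) (HConst l))
  | hat_constM k l : hat_eq (HConst (k * l)) (HMul (HConst k) (HConst l))
  | hat_constC k s : hat_eq (HMul (HConst k) s) (HMul s (HConst k))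
  | hat_linl k (x y : A) (b : B) :
      hat_eq (HGen (k *: x + y) b)
             (HAdd (HMul (HConst k) (HGen x b)) (HGen y b))
  | hat_linr k (x : A) (b c : B) :
      hat_eq (HGen x (k *: b + c))
             (HAdd (HMul (HConst k) (HGen x b)) (HGen x c))
  | hat_genMl (x y : A) (b : B) (s : seq (B * B)) :
      comul B b = \sum_(p <- s) (p.1 \ox p.2) ->
      hat_eq (HGen (x * y) b)
             (HSum [seq HMul (HGen x p.1) (HGen y p.2) | p <- s])
  | hat_gen1l (b : B) : hat_eq (HGen (1 : A) b) (HConst (counit B b : K))
  | hat_genMr (x : A) (b c : B) (s : seq (A * A)) :
      comul A x = \sum_(p <- s) (p.1 \ox p.2) ->
      hat_eq (HGen x (b * c))
             (HSum [seq HMul (HGen p.1 b) (HGen p.2 c) | p <- s])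
  | hat_gen1r (x : A) : hat_eq (HGen x (1 : B)) (HConst (counit A x : K)).

Section Hat.
Variables (K : comPzRingType) (A B : grBialgebra K).
Local Notation term := (hat_term K A B).

HB.instance Definition _ := gen_eqMixin term.
HB.instance Definition _ := gen_choiceMixin term.

Definition hat_rel : rel term := fun s t => `[< hat_eq s t >].

Let hat_rel_refl : reflexive hat_rel.
Proof. by move=> s; apply/asboolP; apply: hat_refl. Qed.
Let hat_rel_sym : symmetric hat_rel.
Proof. by move=> s t; apply/asboolP/asboolP; apply: hat_sym. Qed.
Let hat_rel_trans : transitive hat_rel.
Proof.
by move=> t s u /asboolP st /asboolP tu; apply/asboolP; apply: hat_trans tu.
Qed.
Canonical hat_equiv := EquivRel hat_rel hat_rel_refl hat_rel_sym hat_rel_trans.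

Definition hat : Type := {eq_quot hat_equiv}.
HB.instance Definition _ := Choice.copy hat {eq_quot hat_equiv}.

Definition hat_pi (s : term) : hat := \pi_({eq_quot hat_equiv}) s.
Definition hat_repr (u : hat) : term := repr (u : {eq_quot hat_equiv}).

Lemma hat_piK u : hat_pi (hat_repr u) = u.
Proof. exact: reprK. Qed.
Lemma hat_piP s t : hat_pi s = hat_pi t <-> hat_eq s t.
Proof.
split=> [/eqmodP/asboolP //|h].
by apply/eqmodP/asboolP.
Qed.
Lemma hat_reprK s : hat_eq (hat_repr (hat_pi s)) s.
Proof. by apply/hat_piP; rewrite hat_piK. Qed.
Lemma hat_split (P : hat -> Prop) : (forall s, P (hat_pi s)) -> forall u, P u.
Proof. by move=> h u; rewrite -(hat_piK u). Qed.

Let const k : hat := hat_pi (HConst k).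
Let add (u v : hat) : hat := hat_pi (HAdd (hat_repr u) (hat_repr v)).
Let mul (u v : hat) : hat := hat_pi (HMul (hat_repr u) (hat_repr v)).
Let scl (k : K) (u : hat) : hat := mul (const k) u.

Let addE s t : add (hat_pi s) (hat_pi t) = hat_pi (HAdd s t).
Proof. by apply/hat_piP/hat_add; apply: hat_reprK. Qed.
Let mulE s t : mul (hat_pi s) (hat_pi t) = hat_pi (HMul s t).
Proof. by apply/hat_piP/hat_mul; apply: hat_reprK. Qed.

Let addA : associative add.
Proof.
elim/hat_split=> s; elim/hat_split=> t; elim/hat_split=> u.
by rewrite !addE; apply/hat_piP/hat_addA.
Qed.
Let addC : commutative add.
Proof.
elim/hat_split=> s; elim/hat_split=> t.
by rewrite !addE; apply/hat_piP/hat_addC.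
Qed.
Let add0 : left_id (const 0) add.
Proof. by elim/hat_split=> s; rewrite addE; apply/hat_piP/hat_add0. Qed.
Let mulA : associative mul.
Proof.
elim/hat_split=> s; elim/hat_split=> t; elim/hat_split=> u.
by rewrite !mulE; apply/hat_piP/hat_mulA.
Qed.
Let mul1 : left_id (const 1) mul.
Proof. by elim/hat_split=> s; rewrite mulE; apply/hat_piP/hat_mul1. Qed.
Let constC k u : mul (const k) u = mul u (const k).
Proof.
by elim/hat_split: u => s; rewrite !mulE; apply/hat_piP/hat_constC.
Qed.
Let mulr1 : right_id (const 1) mul.
Proof. by move=> u; rewrite -constC mul1. Qed.
Let mulDl : left_distributive mul add.
Proof.
elim/hat_split=> s; elim/hat_split=> t; elim/hat_split=> u.
by rewrite !(addE, mulE); apply/hat_piP/hat_mulDl.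
Qed.
Let mulDr : right_distributive mul add.
Proof.
elim/hat_split=> s; elim/hat_split=> t; elim/hat_split=> u.
by rewrite !(addE, mulE); apply/hat_piP/hat_mulDr.
Qed.
Let constD k l : const (k + l) = add (const k) (const l).
Proof. by rewrite addE; apply/hat_piP/hat_constD. Qed.
Let constM k l : const (k * l) = mul (const k) (const l).
Proof. by rewrite mulE; apply/hat_piP/hat_constM. Qed.
Let addN : left_inverse (const 0) (scl (-1)) add.
Proof.
move=> u; rewrite -{2}[u]mul1 -mulDl -constD addNr.
by elim/hat_split: u => s; rewrite mulE; apply/hat_piP/hat_mul0.
Qed.
HB.instance Definition _ := GRing.isZmodule.Build hat addA addC add0 addN.

Let sclA k l u : scl k (scl l u) = scl (k * l) u.
Proof. by rewrite /scl constM mulA. Qed.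
Let sclDl u : {morph scl^~ u : k l / k + l}.
Proof. by move=> k l; rewrite /scl constD mulDl. Qed.
Let sclDr : right_distributive scl +%R.
Proof. by move=> k u v; apply: mulDr. Qed.
HB.instance Definition _ :=
  GRing.Zmodule_isLmodule.Build K hat sclA mul1 sclDr sclDl.

Definition hat_mulop : hat -> hat -> hat := mul.
Definition hat_one : hat := const 1.

Lemma hat_mulopA : associative hat_mulop. Proof. exact: mulA. Qed.
Lemma hat_mulop1l : left_id hat_one hat_mulop. Proof. exact: mul1. Qed.
Lemma hat_mulop1r : right_id hat_one hat_mulop. Proof. exact: mulr1. Qed.
Lemma hat_mulopPl k (x y z : hat) :
  hat_mulop (k *: x + y) z = k *: hat_mulop x z + hat_mulop y z.
Proof. by rewrite [LHS]mulDl; congr (_ + _); rewrite [RHS]mulA. Qed.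
Lemma hat_mulopPr k (x y z : hat) :
  hat_mulop x (k *: y + z) = k *: hat_mulop x y + hat_mulop x z.
Proof.
rewrite [LHS]mulDr; congr (_ + _); rewrite /hat_mulop [LHS]mulA -constC.
by rewrite -[LHS]mulA.
Qed.

Definition hgen (x : A) (b : B) : hat := hat_pi (HGen x b).

Lemma hat_piD s t : hat_pi (HAdd s t) = hat_pi s + hat_pi t.
Proof. by symmetry; apply: addE. Qed.
Lemma hat_piM s t : hat_pi (HMul s t) = hat_mulop (hat_pi s) (hat_pi t).
Proof. by symmetry; apply: mulE. Qed.
Lemma hat_piZ k s : hat_pi (HMul (HConst k) s) = k *: hat_pi s.
Proof. by symmetry; apply: mulE. Qed.
Lemma hat_pi_const k : hat_pi (HConst k) = k *: hat_one.
Proof. by symmetry; apply: mulr1. Qed.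
Lemma hat_pi_sum s : hat_pi (HSum s) = \sum_(t <- s) hat_pi t.
Proof.
elim: s => [|t s IH]; first by rewrite big_nil.
by rewrite big_cons -IH -hat_piD.
Qed.

Lemma hat_elim (P : hat -> Prop) :
  (forall x b, P (hgen x b)) -> P hat_one ->
  (forall k u v, P u -> P v -> P (k *: u + v)) ->
  (forall u v, P u -> P v -> P (hat_mulop u v)) -> forall u, P u.
Proof.
move=> Pg P1 PP PM; elim/hat_split; elim=> [x b|k|s hs t ht|s hs t ht].
- exact: Pg.
- have P0 : P 0.
    have e : (-1) *: hat_one + hat_one = 0 by rewrite scaleN1r addNr.
    by rewrite -e; apply: PP.
  by rewrite hat_pi_const -[_ *: _]addr0; apply: PP.
- by rewrite hat_piD -[hat_pi s]scale1r; apply: PP.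
- by rewrite hat_piM; apply: PM.
Qed.

Lemma hgen_bilin : bilin hgen.
Proof.
split=> [b k x y|x k b c].
  by rewrite -hat_piZ -hat_piD; apply/hat_piP/hat_linl.
by rewrite -hat_piZ -hat_piD; apply/hat_piP/hat_linr.
Qed.

Let hat_mulop_bilinB x y :
  bilin (fun b b' : B => hat_mulop (hgen x b) (hgen y b')).
Proof.
split=> [b'|b] k c c'; first by rewrite hgen_bilin.2 hat_mulopPl.
by rewrite hgen_bilin.2 hat_mulopPr.
Qed.
Let hat_mulop_bilinA b c :
  bilin (fun x y : A => hat_mulop (hgen x b) (hgen y c)).
Proof.
split=> [y|x] k z z'; first by rewrite hgen_bilin.1 hat_mulopPl.
by rewrite hgen_bilin.1 hat_mulopPr.
Qed.

Lemma hgenMl x y b : hgen (x * y) b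
  = tlift (fun b' b'' => hat_mulop (hgen x b') (hgen y b'')) (comul B b).
Proof.
rewrite -(tens_piK (comul B b)) (tliftE (hat_mulop_bilinB _ _)).
rewrite (eq_bigr (fun p => hat_pi (HMul (HGen x p.1) (HGen y p.2)))); last first.
  by move=> p _; rewrite hat_piM.
rewrite -(big_map (fun p => HMul (HGen x p.1) (HGen y p.2)) predT hat_pi).
rewrite -hat_pi_sum; apply/hat_piP/hat_genMl.
by rewrite -tens_pi_sum tens_piK.
Qed.
Lemma hgenMr x b c : hgen x (b * c)
  = tlift (fun x' x'' => hat_mulop (hgen x' b) (hgen x'' c)) (comul A x).
Proof.
rewrite -(tens_piK (comul A x)) (tliftE (hat_mulop_bilinA _ _)).
rewrite (eq_bigr (fun p => hat_pi (HMul (HGen p.1 b) (HGen p.2 c)))); last first.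
  by move=> p _; rewrite hat_piM.
rewrite -(big_map (fun p => HMul (HGen p.1 b) (HGen p.2 c)) predT hat_pi).
rewrite -hat_pi_sum; apply/hat_piP/hat_genMr.
by rewrite -tens_pi_sum tens_piK.
Qed.
Lemma hgen1l b : hgen 1 b = (counit B b : K) *: hat_one.
Proof. by rewrite -hat_pi_const; apply/hat_piP/hat_gen1l. Qed.
Lemma hgen1r x : hgen x 1 = (counit A x : K) *: hat_one.
Proof. by rewrite -hat_pi_const; apply/hat_piP/hat_gen1r. Qed.

(* the grading such that |x_b| = |x| + |b| *)
Inductive hat_homog : int -> hat -> Prop :=
  | hat_homog0 p : hat_homog p 0
  | hat_homogP p k u v :
      hat_homog p u -> hat_homog p v -> hat_homog p (k *: u + v)
  | hat_homog1 : hat_homog 0 hat_one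
  | hat_homogM p q u v :
      hat_homog p u -> hat_homog q v -> hat_homog (p + q) (hat_mulop u v)
  | hat_homog_gen p q x b :
      homog p x -> homog q b -> hat_homog (p + q) (hgen x b).

(* Action of an expression on the sequences [int -> hat], where a homogeneous
   element of degree [p] acts by multiplication and a shift of [p]; it is used
   to show that the homogeneous parts of [hat] are independent *)
Fixpoint hact (t : term) (h : int -> hat) (n : int) : hat :=
  match t with
  | HGen x b => dsum (fun i x_i => dsum (fun j b_j =>
      hat_mulop (hgen x_i b_j) (h (n - (i + j)))) b) x
  | HConst k => k *: h n
  | HAdd s t => hact s h n + hact t h n
  | HMul s t => hact s (hact t h) n
  end.

Let opl (u : hat) : linear (hat_mulop u).
Proof. by move=> k v w; apply: hat_mulopPr. Qed.
Let opr (v : hat) : linear (hat_mulop^~ v).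
Proof. by move=> k u w; apply: hat_mulopPl. Qed.

Let hact_gen (h : int -> hat) n (x : A) (b : B) : hat :=
  dsum (fun i x_i => dsum (fun j b_j =>
      hat_mulop (hgen x_i b_j) (h (n - (i + j)))) b) x.

Let hact_gen_lin1 (h : int -> hat) (n i j : int) x :
  linear (fun b => hat_mulop (hgen x b) (h (n - (i + j)))).
Proof. by move=> k b c; rewrite hgen_bilin.2 hat_mulopPl. Qed.
Let hact_gen_lin2 (h : int -> hat) (n i : int) (b : B) :
  linear (fun x => dsum (fun j b_j =>
      hat_mulop (hgen x b_j) (h (n - (i + j)))) b).
Proof.
move=> k x y; apply: dsum_param => j b_j.
by rewrite hgen_bilin.1 hat_mulopPl.
Qed.
Let hact_gen_bilin h n : bilin (hact_gen h n).
Proof.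
split=> [b|x]; first by apply: dsum_linear => i; apply: hact_gen_lin2.
by move=> k b c; apply: dsum_param => i x_i; apply: dsum_linear.
Qed.
Let hact_gen_homog h n p q x b : homog p x -> homog q b ->
  hact_gen h n x b = hat_mulop (hgen x b) (h (n - (p + q))).
Proof.
move=> hx hb; rewrite /hact_gen (dsum_homog _ hx); last first.
  by move=> i; apply: linear0_of (hact_gen_lin2 _ _ _ _).
by apply: dsum_homog hb => j; apply: linear0_of (hact_gen_lin1 _ _ _ _ _).
Qed.

Lemma hact_lin t k h h' :
  hact t (fun n => k *: h n + h' n) = fun n => k *: hact t h n + hact t h' n.
Proof.
elim: t h h' => [x b|l|s hs t ht|s hs t ht] h h'; apply/funext => n /=.
- apply: dsum_param => i x_i; apply: dsum_param => j b_j.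
  by rewrite hat_mulopPr.
- by rewrite scalerDr !scalerA mulrC.
- by rewrite hs ht scalerDr addrACA.
- by rewrite ht hs.
Qed.
Lemma hactD t h h' :
  hact t (fun n => h n + h' n) = fun n => hact t h n + hact t h' n.
Proof.
have -> : (fun n => h n + h' n) = (fun n => 1 *: h n + h' n).
  by apply/funext => n; rewrite scale1r.
by rewrite hact_lin; apply/funext => n; rewrite scale1r.
Qed.
Lemma hact0 t : hact t (fun=> 0) = fun=> 0.
Proof.
have e := hactD t (fun=> 0) (fun=> 0).
rewrite addr0 in e; apply/funext => n.
by apply: (addrI (hact t (fun=> 0) n)); rewrite addr0 {3}e.
Qed.
Lemma hactZ t k h : hact t (fun n => k *: h n) = fun n => k *: hact t h n.
Proof.
have -> : (fun n => k *: h n) = (fun n => k *: h n + (fun=> 0) n).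
  by apply/funext => n; rewrite addr0.
by rewrite hact_lin hact0; apply/funext => n; rewrite addr0.
Qed.

Lemma hact_sum s h n : hact (HSum s) h n = \sum_(t <- s) hact t h n.
Proof.
elim: s => [|t s IH] /=; first by rewrite big_nil scale0r.
by rewrite big_cons IH.
Qed.

Let hact_bilinB x y h n :
  bilin (fun b c => hact (HGen x b) (hact (HGen y c) h) n).
Proof.
split=> [c|b] k d d'.
  exact: (hact_gen_bilin (hact (HGen y c) h) n).2.
have -> : hact (HGen y (k *: d + d')) h
    = fun n => k *: hact (HGen y d) h n + hact (HGen y d') h n.
  by apply/funext => m; apply: (hact_gen_bilin h m).2.
by rewrite hact_lin.
Qed.
Let hact_bilinA b c h n :
  bilin (fun x y => hact (HGen x b) (hact (HGen y c) h) n).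
Proof.
split=> [y|x] k d d'.
  exact: (hact_gen_bilin (hact (HGen y c) h) n).1.
have -> : hact (HGen (k *: d + d') c) h
    = fun n => k *: hact (HGen d c) h n + hact (HGen d' c) h n.
  by apply/funext => m; apply: (hact_gen_bilin h m).1.
by rewrite hact_lin.
Qed.

Let hact_genMl (x y : A) (b : B) h n : hact (HGen (x * y) b) h n
  = tlift (fun b' b'' => hact (HGen x b') (hact (HGen y b'') h) n) (comul B b).
Proof.
elim/homog_ind: x y b => [y b|x x' hx hx' y b|i x hx y b].
- rewrite mul0r [LHS](linear0_of ((hact_gen_bilin h n).1 b)).
  rewrite /tlift big1 // => p _.
  exact: (linear0_of ((hact_gen_bilin _ n).1 p.1)).
- rewrite mulrDl; rewrite [LHS](bilinDl (x * y) (x' * y) b (hact_gen_bilin h n)).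
  rewrite [X in X + _ = _]hx [X in _ + X = _]hx' -big_split; apply: eq_bigr => p _.
  symmetry; exact: bilinDl x x' p.1 (hact_gen_bilin (hact (HGen y p.2) h) n).
elim/homog_ind: y b => [b|y y' hy hy' b|j y hy b].
- rewrite mulr0 [LHS](linear0_of ((hact_gen_bilin h n).1 b)).
  rewrite /tlift big1 // => p _.
  exact: (linear0_of ((hact_bilinA _ _ h n).2 x)).
- rewrite mulrDr; rewrite [LHS](bilinDl (x * y) (x * y') b (hact_gen_bilin h n)).
  rewrite [X in X + _ = _]hy [X in _ + X = _]hy' -big_split; apply: eq_bigr => p _.
  symmetry; exact: bilinDr x y y' (hact_bilinA p.1 p.2 h n).
elim/homog_ind: b => [|b c hb hc|k b hb].
- rewrite [LHS](linear0_of ((hact_gen_bilin h n).2 (x * y))).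
  by rewrite linear0 (tlift0 (hact_bilinB _ _ _ _)).
- rewrite [LHS](bilinDr (x * y) b c (hact_gen_bilin h n)).
  by rewrite [X in X + _ = _]hb [X in _ + X = _]hc linearD (tliftD (hact_bilinB _ _ _ _)).
rewrite [LHS](hact_gen_homog _ _ (homogM hx hy) hb) hgenMl.
have e1 := hat_mulop_bilinB x y; have e2 := hact_bilinB x y h n.
elim: {b hb} (grHom_homog (comul B) hb) => [q|q l u v _ hu _ hv|p q b c hb hc].
- by rewrite (tlift0 e1) (tlift0 e2); apply: (linear0_of (opr _)).
- by rewrite (tlift_linear e1) (tlift_linear e2) hat_mulopPl hu hv.
rewrite (tlift_pure e1) (tlift_pure e2) [RHS](hact_gen_homog _ _ hx hb).
rewrite [X in _ = hat_mulop _ X](hact_gen_homog _ _ hy hc) hat_mulopA.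
congr (hat_mulop _ (h _)).
by rewrite [i + j + _]addrACA opprD addrA.
Qed.

Let hact_genMr (x : A) (b c : B) h n : hact (HGen x (b * c)) h n
  = tlift (fun x' x'' => hact (HGen x' b) (hact (HGen x'' c) h) n) (comul A x).
Proof.
elim/homog_ind: b c x => [c x|b b' hb hb' c x|i b hb c x].
- rewrite mul0r [LHS](linear0_of ((hact_gen_bilin h n).2 x)).
  rewrite /tlift big1 // => p _.
  exact: (linear0_of ((hact_gen_bilin _ n).2 p.1)).
- rewrite mulrDl; rewrite [LHS](bilinDr x (b * c) (b' * c) (hact_gen_bilin h n)).
  rewrite [X in X + _ = _]hb [X in _ + X = _]hb' -big_split; apply: eq_bigr => p _.
  symmetry; exact: bilinDr p.1 b b' (hact_gen_bilin (hact (HGen p.2 c) h) n).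
elim/homog_ind: c x => [x|c c' hc hc' x|j c hc x].
- rewrite mulr0 [LHS](linear0_of ((hact_gen_bilin h n).2 x)).
  rewrite /tlift big1 // => p _.
  exact: (linear0_of ((hact_bilinB _ _ h n).2 b)).
- rewrite mulrDr; rewrite [LHS](bilinDr x (b * c) (b * c') (hact_gen_bilin h n)).
  rewrite [X in X + _ = _]hc [X in _ + X = _]hc' -big_split; apply: eq_bigr => p _.
  symmetry; exact: bilinDr b c c' (hact_bilinB p.1 p.2 h n).
elim/homog_ind: x => [|x y hx hy|k x hx].
- rewrite [LHS](linear0_of ((hact_gen_bilin h n).1 (b * c))).
  by rewrite linear0 (tlift0 (hact_bilinA _ _ _ _)).
- rewrite [LHS](bilinDl x y (b * c) (hact_gen_bilin h n)).
  by rewrite [X in X + _ = _]hx [X in _ + X = _]hy linearD (tliftD (hact_bilinA _ _ _ _)).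
rewrite [LHS](hact_gen_homog _ _ hx (homogM hb hc)) hgenMr.
have e1 := hat_mulop_bilinA b c; have e2 := hact_bilinA b c h n.
elim: {x hx} (grHom_homog (comul A) hx) => [q|q l u v _ hu _ hv|p q x y hx hy].
- by rewrite (tlift0 e1) (tlift0 e2); apply: (linear0_of (opr _)).
- by rewrite (tlift_linear e1) (tlift_linear e2) hat_mulopPl hu hv.
rewrite (tlift_pure e1) (tlift_pure e2) [RHS](hact_gen_homog _ _ hx hb).
rewrite [X in _ = hat_mulop _ X](hact_gen_homog _ _ hy hc) hat_mulopA.
congr (hat_mulop _ (h _)).
by rewrite addrACA opprD addrA.
Qed.

Let hact_gen1l (b : B) h n : hact (HGen (1 : A) b) h n = (counit B b : K) *: h n.
Proof.
elim/homog_ind: b => [|b c hb hc|k b hb].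
- by rewrite [LHS](linear0_of ((hact_gen_bilin h n).2 1)) linear0 scale0r.
- rewrite [LHS](bilinDr (1 : A) b c (hact_gen_bilin h n)).
  by rewrite [X in X + _ = _]hb [X in _ + X = _]hc linearD scalerDl.
rewrite [LHS](hact_gen_homog _ _ (homog1 A) hb) hgen1l.
rewrite -[_ *: _]addr0 hat_mulopPl hat_mulop1l (linear0_of (opr _)) addr0.
case: (grHom_homog (counit B) hb) => [->|->]; last by rewrite !scale0r.
by rewrite addr0.
Qed.
Let hact_gen1r (x : A) h n : hact (HGen x (1 : B)) h n = (counit A x : K) *: h n.
Proof.
elim/homog_ind: x => [|x y hx hy|k x hx].
- by rewrite [LHS](linear0_of ((hact_gen_bilin h n).1 1)) linear0 scale0r.
- rewrite [LHS](bilinDl x y (1 : B) (hact_gen_bilin h n)).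
  by rewrite [X in X + _ = _]hx [X in _ + X = _]hy linearD scalerDl.
rewrite [LHS](hact_gen_homog _ _ hx (homog1 B)) hgen1r.
rewrite -[_ *: _]addr0 hat_mulopPl hat_mulop1l (linear0_of (opr _)) addr0.
case: (grHom_homog (counit A) hx) => [->|->]; last by rewrite !scale0r.
by rewrite addr0.
Qed.

Lemma hact_eq s t : hat_eq s t -> hact s = hact t.
Proof.
elim=> {s t} //=.
- by move=> s t u _ -> _ ->.
- by move=> s s' t t' _ hs _ ht; apply/funext => h; apply/funext => n /=; rewrite hs ht.
- by move=> s s' t t' _ hs _ ht; apply/funext => h; apply/funext => n /=; rewrite hs ht.
- by move=> s t u; apply/funext => h; apply/funext => n /=; rewrite addrA.
- by move=> s t; apply/funext => h; apply/funext => n /=; rewrite addrC.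
- by move=> s; apply/funext => h; apply/funext => n /=; rewrite scale0r add0r.
- by move=> s; apply/funext => h; apply/funext => n /=; rewrite scale1r.
- by move=> s; apply/funext => h; apply/funext => n /=; rewrite !scale0r.
- by move=> s t u; apply/funext => h; apply/funext => n /=; rewrite hactD.
- by move=> k l; apply/funext => h; apply/funext => n /=; rewrite scalerDl.
- by move=> k l; apply/funext => h; apply/funext => n /=; rewrite scalerA.
- by move=> k s; apply/funext => h; apply/funext => n /=; rewrite hactZ.
- by move=> k x y b; apply/funext => h; apply/funext => n; apply: (hact_gen_bilin h n).1.
- by move=> k x b c; apply/funext => h; apply/funext => n; apply: (hact_gen_bilin h n).2.
- move=> x y b s e; apply/funext => h; apply/funext => n.
  rewrite hact_sum big_map -[LHS]/(hact (HGen (x * y) b) h n) hact_genMl e.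
  by rewrite (tlift_sum (hact_bilinB _ _ _ _)).
- by move=> b; apply/funext => h; apply/funext => n; apply: hact_gen1l.
- move=> x b c s e; apply/funext => h; apply/funext => n.
  rewrite hact_sum big_map -[LHS]/(hact (HGen x (b * c)) h n) hact_genMr e.
  by rewrite (tlift_sum (hact_bilinA _ _ _ _)).
- by move=> x; apply/funext => h; apply/funext => n; apply: hact_gen1r.
Qed.

Definition hatact (u : hat) := hact (hat_repr u).
Lemma hatactE s : hatact (hat_pi s) = hact s.
Proof. exact/hact_eq/hat_reprK. Qed.
Lemma hatactP k u v h n : hatact (k *: u + v) h n = k *: hatact u h n + hatact v h n.
Proof.
elim/hat_split: u => s; elim/hat_split: v => t.
by rewrite -hat_piZ -hat_piD !hatactE.
Qed.
Lemma hatactM u v h n : hatact (hat_mulop u v) h n = hatact u (hatact v h) n.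
Proof.
by elim/hat_split: u => s; elim/hat_split: v => t; rewrite -hat_piM !hatactE.
Qed.
Lemma hatact_homog p u h n : hat_homog p u -> hatact u h n = hat_mulop u (h (n - p)).
Proof.
move=> hu; elim: hu h n => {p u} [p|p k u v _ hu _ hv||p q u v _ hu _ hv|p q x b hx hb] h n.
- rewrite (linear0_of (opr _)).
  have := hatactP (-1) 0 0 h n; rewrite scaler0 addr0 scaleN1r => ->.
  by rewrite addNr.
- by rewrite hatactP hu hv hat_mulopPl.
- by rewrite hatactE /= scale1r subr0 hat_mulop1l.
- by rewrite hatactM hu hv hat_mulopA opprD addrA.
- by rewrite hatactE; apply: hact_gen_homog.
Qed.

Lemma hat_indep : independent hat_homog.
Proof.
pose e0 (n : int) : hat := if n == 0 then hat_one else 0.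
apply: (@independent_proj _ _ (fun n u => hatact u e0 n)) => [n u v|n q u hu].
  by rewrite -[u]scale1r hatactP !scale1r.
rewrite (hatact_homog _ _ hu) /e0 subr_eq0.
by case: ifP => _; rewrite ?hat_mulop1r // (linear0_of (opl _)).
Qed.

Lemma hat_gen u : fin_sum_of hat_homog u.
Proof.
elim/hat_elim: u => [x b||k u v|u v].
- have : fin_sum_of hat_homog (tlift hgen (x \ox b)).
    elim/tens_homog_ind': (x \ox b) => [|t t' ht ht'|i j y c hy hc].
    + by rewrite (tlift0 hgen_bilin); apply: fin_sum0.
    + by rewrite (tliftD hgen_bilin); apply: fin_sumD.
    rewrite (tlift_pure hgen_bilin).
    by apply: (@fin_sum1 _ _ (i + j)); apply: hat_homog_gen.
  by rewrite (tlift_pure hgen_bilin).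
- by apply: (@fin_sum1 _ _ 0); apply: hat_homog1.
- move=> hu hv; apply: fin_sumD => //.
  elim/fin_sum_ind: u / hu => [|z w hz hw|p z hz].
  + by rewrite scaler0; apply: fin_sum0.
  + by rewrite scalerDr; apply: fin_sumD.
  apply: (@fin_sum1 _ _ p); rewrite -[_ *: _]addr0.
  by apply: hat_homogP => //; apply: hat_homog0.
move=> hu hv.
have oplD w : {morph hat_mulop w : x y / x + y}.
  by move=> x y; rewrite -[x]scale1r hat_mulopPr !scale1r.
have oprD w : {morph hat_mulop^~ w : x y / x + y}.
  by move=> x y; rewrite -[x]scale1r hat_mulopPl !scale1r.
elim/fin_sum_ind: u / hu => [|z w hz hw|p z hz].
- by rewrite (linear0_of (opr _)); apply: fin_sum0.
- by rewrite oprD; apply: fin_sumD.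
elim/fin_sum_ind: v / hv => [|z' w' hz' hw'|q z' hz'].
- by rewrite (linear0_of (opl _)); apply: fin_sum0.
- by rewrite oplD; apply: fin_sumD.
by apply: (@fin_sum1 _ _ (p + q)); apply: hat_homogM.
Qed.

(* the graded algebra generated by the [x_b], without commutativity *)
Definition gr_hat : grAlgebra K :=
  GrAlgebra hat_mulopA hat_mulop1l hat_mulop1r hat_mulopPl hat_mulopPr hat_homog0
    hat_homogP hat_gen hat_indep hat_homog1 hat_homogM.
End Hat.

(* a family of relations [x = y] between homogeneous elements of equal degree *)
Record homRel (K : comPzRingType) (G : grAlgebra K) := HomRel {
  hrel :> G -> G -> Prop;
  hrel_homog : forall x y, hrel x y -> exists p, homog p x /\ homog p y
}.

Inductive quot_eq (K : comPzRingType) (G : grAlgebra K) (r : G -> G -> Prop) :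
    G -> G -> Prop :=
  | quot_refl x : quot_eq r x x
  | quot_sym x y : quot_eq r x y -> quot_eq r y x
  | quot_trans x y z : quot_eq r x y -> quot_eq r y z -> quot_eq r x z
  | quot_lin k x x' y y' : quot_eq r x x' -> quot_eq r y y' ->
      quot_eq r (k *: x + y) (k *: x' + y')
  | quot_mul x x' y y' : quot_eq r x x' -> quot_eq r y y' ->
      quot_eq r (x * y) (x' * y')
  | quot_rel x y : r x y -> quot_eq r x y.

(* the quotient of [G] by the two-sided ideal generated by the [x - y], [r x y] *)
Section Quotient.
Variables (K : comPzRingType) (G : grAlgebra K) (r : homRel G).

Definition quot_erel : rel G := fun x y => `[< quot_eq r x y >].
Let quot_erel_refl : reflexive quot_erel.
Proof. by move=> x; apply/asboolP; apply: quot_refl. Qed.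
Let quot_erel_sym : symmetric quot_erel.
Proof. by move=> x y; apply/asboolP/asboolP; apply: quot_sym. Qed.
Let quot_erel_trans : transitive quot_erel.
Proof.
by move=> y x z /asboolP xy /asboolP yz; apply/asboolP; apply: quot_trans yz.
Qed.
Canonical quot_equiv :=
  EquivRel quot_erel quot_erel_refl quot_erel_sym quot_erel_trans.

Definition quot : Type := {eq_quot quot_equiv}.
HB.instance Definition _ := Choice.copy quot {eq_quot quot_equiv}.

Definition quot_pi (x : G) : quot := \pi_({eq_quot quot_equiv}) x.
Definition quot_repr (u : quot) : G := repr (u : {eq_quot quot_equiv}).

Lemma quot_piK u : quot_pi (quot_repr u) = u.
Proof. exact: reprK. Qed.
Lemma quot_piP x y : quot_pi x = quot_pi y <-> quot_eq r x y.
Proof.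
split=> [/eqmodP/asboolP //|h].
by apply/eqmodP/asboolP.
Qed.
Lemma quot_reprK x : quot_eq r (quot_repr (quot_pi x)) x.
Proof. by apply/quot_piP; rewrite quot_piK. Qed.
Lemma quot_split (P : quot -> Prop) : (forall x, P (quot_pi x)) -> forall u, P u.
Proof. by move=> h u; rewrite -(quot_piK u). Qed.

Lemma quot_add x x' y y' : quot_eq r x x' -> quot_eq r y y' ->
  quot_eq r (x + y) (x' + y').
Proof. by move=> hx hy; rewrite -[x]scale1r -[x']scale1r; apply: quot_lin. Qed.
Lemma quot_scale k x x' : quot_eq r x x' -> quot_eq r (k *: x) (k *: x').
Proof.
by move=> h; rewrite -[k *: x]addr0 -[k *: x']addr0; apply/quot_lin/quot_refl.
Qed.

Let add (u v : quot) : quot := quot_pi (quot_repr u + quot_repr v).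
Let scl (k : K) (u : quot) : quot := quot_pi (k *: quot_repr u).
Definition quot_mulop (u v : quot) : quot := quot_pi (quot_repr u * quot_repr v).
Definition quot_one : quot := quot_pi 1.

Let addE x y : add (quot_pi x) (quot_pi y) = quot_pi (x + y).
Proof. by apply/quot_piP/quot_add; apply: quot_reprK. Qed.
Let sclE k x : scl k (quot_pi x) = quot_pi (k *: x).
Proof. by apply/quot_piP/quot_scale/quot_reprK. Qed.
Lemma quot_piM x y : quot_pi (x * y) = quot_mulop (quot_pi x) (quot_pi y).
Proof. by symmetry; apply/quot_piP/quot_mul; apply: quot_reprK. Qed.

Let addA : associative add.
Proof.
elim/quot_split=> x; elim/quot_split=> y; elim/quot_split=> z.
by rewrite !addE addrA.
Qed.
Let addC : commutative add.
Proof. by elim/quot_split=> x; elim/quot_split=> y; rewrite !addE addrC. Qed.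
Let add0 : left_id (quot_pi 0) add.
Proof. by elim/quot_split=> x; rewrite addE add0r. Qed.
Let addN : left_inverse (quot_pi 0) (scl (-1)) add.
Proof. by elim/quot_split=> x; rewrite sclE addE scaleN1r addNr. Qed.
HB.instance Definition _ := GRing.isZmodule.Build quot addA addC add0 addN.

Let sclA k l u : scl k (scl l u) = scl (k * l) u.
Proof. by elim/quot_split: u => x; rewrite !sclE scalerA. Qed.
Let scl1 : left_id 1 scl.
Proof. by elim/quot_split=> x; rewrite sclE scale1r. Qed.
Let sclDr : right_distributive scl +%R.
Proof.
move=> k; elim/quot_split=> x; elim/quot_split=> y.
by rewrite [quot_pi x + _]addE !sclE scalerDr; symmetry; apply: addE.
Qed.
Let sclDl u : {morph scl^~ u : k l / k + l}.
Proof.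
move=> k l; elim/quot_split: u => x; rewrite !sclE scalerDl.
by symmetry; apply: addE.
Qed.
HB.instance Definition _ :=
  GRing.Zmodule_isLmodule.Build K quot sclA scl1 sclDr sclDl.

Lemma quot_pi_linear : linear quot_pi.
Proof. by move=> k x y; rewrite -addE -sclE. Qed.

Let mulA : associative quot_mulop.
Proof.
elim/quot_split=> x; elim/quot_split=> y; elim/quot_split=> z.
by rewrite -!quot_piM mulrA.
Qed.
Let mul1 : left_id quot_one quot_mulop.
Proof. by elim/quot_split=> x; rewrite -quot_piM mul1r. Qed.
Let mulr1 : right_id quot_one quot_mulop.
Proof. by elim/quot_split=> x; rewrite -quot_piM mulr1. Qed.
Let mulPl k u v w :
  quot_mulop (k *: u + v) w = k *: quot_mulop u w + quot_mulop v w.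
Proof.
elim/quot_split: u => x; elim/quot_split: v => y; elim/quot_split: w => z.
by rewrite -quot_pi_linear -!quot_piM -quot_pi_linear mulrDl gr_scalerAl.
Qed.
Let mulPr k u v w :
  quot_mulop u (k *: v + w) = k *: quot_mulop u v + quot_mulop u w.
Proof.
elim/quot_split: u => x; elim/quot_split: v => y; elim/quot_split: w => z.
by rewrite -quot_pi_linear -!quot_piM -quot_pi_linear mulrDr gr_scalerAr.
Qed.

Definition quot_homog (p : int) (u : quot) : Prop :=
  exists2 x : G, homog p x & u = quot_pi x.

Let homog_zero p : quot_homog p 0.
Proof. by exists 0 => //; apply: homog0. Qed.
Let homog_lin p k u v :
  quot_homog p u -> quot_homog p v -> quot_homog p (k *: u + v).
Proof.
move=> [x hx ->] [y hy ->]; exists (k *: x + y); first exact: homogP.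
by rewrite quot_pi_linear.
Qed.
Let homog_one : quot_homog 0 quot_one.
Proof. by exists 1 => //; apply: homog1. Qed.
Let homog_mul p q u v :
  quot_homog p u -> quot_homog q v -> quot_homog (p + q) (quot_mulop u v).
Proof.
move=> [x hx ->] [y hy ->]; exists (x * y); first exact: homogM.
by rewrite quot_piM.
Qed.
Let quot_gen u : fin_sum_of quot_homog u.
Proof.
elim/quot_split: u => x; elim/homog_ind: x => [|x y hx hy|p x hx].
- by rewrite (linear0_of quot_pi_linear); apply: fin_sum0.
- rewrite -[x]scale1r quot_pi_linear scale1r; exact: fin_sumD.
- by apply: (@fin_sum1 _ _ p); exists x.
Qed.

Lemma hcompM n (x y : G) :
  hcomp n (x * y) = dsum (fun i x_i => x_i * hcomp (n - i) y) x.
Proof.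
have hl (i : int) : linear (fun x_i : G => x_i * hcomp (n - i) y).
  by move=> k z z'; rewrite mulrDl gr_scalerAl.
have hD : {morph hcomp n : a b / a + b :> G}.
  by move=> a b; rewrite -[a]scale1r hcomp_linear !scale1r.
have dD : {morph dsum (fun i x_i => x_i * hcomp (n - i) y) : a b / a + b :> G}.
  by move=> a b; rewrite -[a]scale1r dsum_linear // !scale1r.
elim/homog_ind: x => [|x x' hx hx'|i x hx].
- by rewrite mul0r (linear0_of (hcomp_linear n)) (linear0_of (dsum_linear hl)).
- by rewrite mulrDl hD dD hx hx'.
rewrite (dsum_homog _ hx); last by move=> p; rewrite mul0r.
have hnD : {morph hcomp (n - i) : a b / a + b :> G}.
  by move=> a b; rewrite -[a]scale1r hcomp_linear !scale1r.
elim/homog_ind: y {hl dD} => [|y y' hy hy'|j y hy].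
- by rewrite mulr0 !(linear0_of (hcomp_linear _)) mulr0.
- by rewrite mulrDr hD hnD hy hy' mulrDr.
rewrite (hcomp_homog _ (homogM hx hy)) (hcomp_homog _ hy).
rewrite -(inj_eq (addrI (- i))) [- i + n]addrC addKr.
by case: eqP => _ //; rewrite mulr0.
Qed.

Lemma quot_eq_sum (s : seq int) (f g : int -> G) :
  (forall i, quot_eq r (f i) (g i)) ->
  quot_eq r (\sum_(i <- s) f i) (\sum_(i <- s) g i).
Proof.
move=> h; elim: s => [|i s IH]; first by rewrite !big_nil; apply: quot_refl.
by rewrite !big_cons; apply: quot_add.
Qed.

Lemma quot_eq_hcomp x y : quot_eq r x y ->
  forall n, quot_eq r (hcomp n x) (hcomp n y).
Proof.
elim=> {x y} [x|x y _ h|x y z _ h _ h'|k x x' y y' _ h _ h'|x x' y y' _ h _ h'|x y h] n.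
- exact: quot_refl.
- exact: quot_sym.
- exact: quot_trans (h n) (h' n).
- by rewrite !hcomp_linear; apply: quot_lin.
- rewrite !hcompM; set t := undup (hsupp x ++ hsupp x').
  rewrite (@dsumE _ _ _ _ x t) ?undup_uniq //; first last.
  + by move=> q qx; rewrite mem_undup mem_cat [q \in hsupp x]qx.
  + by move=> p; rewrite mul0r.
  rewrite (@dsumE _ _ _ _ x' t) ?undup_uniq //; first last.
  + by move=> q qx; rewrite mem_undup mem_cat [q \in hsupp x']qx orbT.
  + by move=> p; rewrite mul0r.
  by apply: quot_eq_sum => i; apply: quot_mul.
have [p [hx hy]] := hrel_homog h.
rewrite (hcomp_homog _ hx) (hcomp_homog _ hy); case: ifP => _.
  exact: quot_rel.
exact: quot_refl.
Qed.

Let quot_indep : independent quot_homog.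
Proof.
have prE n x : quot_pi (hcomp n (quot_repr (quot_pi x))) = quot_pi (hcomp n x).
  by apply/quot_piP/quot_eq_hcomp/quot_reprK.
apply: (@independent_proj _ _ (fun n u => quot_pi (hcomp n (quot_repr u)))).
  move=> n; elim/quot_split=> x; elim/quot_split=> y.
  have e : quot_pi x + quot_pi y = quot_pi (1 *: x + y).
    by rewrite quot_pi_linear scale1r.
  by rewrite e !prE hcomp_linear quot_pi_linear scale1r.
move=> n q u [x hx ->]; rewrite prE (hcomp_homog _ hx).
by case: ifP => _ //; apply: (linear0_of quot_pi_linear).
Qed.

Definition gr_quot : grAlgebra K :=
  GrAlgebra mulA mul1 mulr1 mulPl mulPr homog_zero homog_lin
    quot_gen quot_indep homog_one homog_mul.
End Quotient.

Section CommutativeQuotient.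
Variables (K : comPzRingType) (A B : grBialgebra K).

(* x_b y_c = (-1)^(|x_b||y_c|) y_c x_b for homogeneous x, b, y, c *)
Inductive comm_rel : gr_hat A B -> gr_hat A B -> Prop :=
  CommRel p q p' q' (x y : A) (b c : B) :
    homog p x -> homog q b -> homog p' y -> homog q' c ->
    comm_rel ((hgen x b : gr_hat A B) * (hgen y c : gr_hat A B))
      (gsign (p + q) (p' + q')
        *: ((hgen y c : gr_hat A B) * (hgen x b : gr_hat A B))).

Let comm_rel_homog u v : comm_rel u v -> exists p, homog p u /\ homog p v.
Proof.
case=> p q p' q' x y b c hx hb hy hc; exists ((p + q) + (p' + q')); split.
  by apply: homogM; apply: hat_homog_gen.
by rewrite addrC; apply/homogZ/homogM; apply: hat_homog_gen.
Qed.

Definition comm_homRel : homRel (gr_hat A B) := HomRel comm_rel_homog.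

Let Q := gr_quot comm_homRel.

Let comm_ax p q (u v : Q) :
  homog p u -> homog q v -> u * v = (gsign p q : K) *: (v * u).
Proof.
pose piM (x y : gr_hat A B) : (quot_pi comm_homRel x : Q) * (quot_pi comm_homRel y : Q)
    = quot_pi comm_homRel (x * y) := esym (quot_piM comm_homRel x y).
have piP k (x y : gr_hat A B) : (quot_pi comm_homRel (k *: x + y) : Q)
    = k *: (quot_pi comm_homRel x : Q) + (quot_pi comm_homRel y : Q).
  exact: quot_pi_linear.
have pi0 : (quot_pi comm_homRel 0 : Q) = 0 by [].
have piZ k (x : gr_hat A B) : (quot_pi comm_homRel (k *: x) : Q)
    = k *: (quot_pi comm_homRel x : Q).
  by have := piP k x 0; rewrite addr0 pi0 addr0.
move=> [x hx ->] [y hy ->].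
pose C p q x y := (quot_pi comm_homRel x : Q) * (quot_pi comm_homRel y : Q)
  = (gsign p q : K) *: ((quot_pi comm_homRel y : Q) * (quot_pi comm_homRel x : Q)).
have C0r p0 q0 x0 : C p0 q0 x0 0 by rewrite /C pi0 mulr0 mul0r scaler0.
have CPr p0 q0 k x0 y0 y1 : C p0 q0 x0 y0 -> C p0 q0 x0 y1 -> C p0 q0 x0 (k *: y0 + y1).
  rewrite /C => h0 h1; rewrite piP mulrDr mulrDl scalerDr h1 -gr_scalerAr h0.
  by rewrite -gr_scalerAl !scalerA mulrC.
have C1r p0 x0 : C p0 0 x0 1.
  rewrite /C gsign0r scale1r; have -> : (quot_pi comm_homRel 1 : Q) = 1 by [].
  by rewrite mulr1 mul1r.
have CMr p0 q0 q1 x0 y0 y1 : C p0 q0 x0 y0 -> C p0 q1 x0 y1 ->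
    C p0 (q0 + q1) x0 (y0 * y1).
  rewrite /C => h0 h1; rewrite -piM mulrA h0 -gr_scalerAl -mulrA h1.
  by rewrite -gr_scalerAr scalerA gsignDr mulrA.
have sgnK i j : (gsign j i : K) * gsign i j = 1.
  by rewrite /gsign [j * i]mulrC -exprD addnn -signr_odd odd_double.
have Csym i j x0 y0 : C i j x0 y0 -> C j i y0 x0.
  by rewrite /C => ->; rewrite scalerA sgnK scale1r.
suff : C p q x y by [].
have gens i j i' j' x0 b0 y0 c0 : homog i x0 -> homog j b0 ->
   homog i' y0 -> homog j' c0 -> C (i + j) (i' + j') (hgen x0 b0) (hgen y0 c0).
  move=> h1 h2 h3 h4; rewrite /C !piM.
  by rewrite -piZ; apply/quot_piP/quot_rel; apply: CommRel.
elim: hy p x hx => {q y} [q p x _|q k y y' _ hy _ hy' p x hx|p x _|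
    q q' y y' _ hy _ hy' p x hx|i' j' y c hy hc p x hx].
- exact: C0r.
- by apply: CPr; [apply: hy|apply: hy'].
- exact: C1r.
- by apply: CMr; [apply: hy|apply: hy'].
apply: Csym; elim: hx => {p x} [p|p k x x' _ hx _ hx'||p p' x x' _ hx _ hx'|i j x b hx hb].
- exact: C0r.
- exact: CPr.
- exact: C1r.
- exact: CMr.
exact: gens.
Qed.

Definition cgr_hat : cgrAlgebra K := CGrAlgebra comm_ax.
End CommutativeQuotient.

(* Main.v *)
Require Import Defs.
From mathcomp Require Import all_boot all_algebra.
From mathcomp Require Import boolp functions.

(** The algebra [gr_hat A B] is presented by generators [x_b] and relations,
so a graded homomorphism [f : gr_hat A B -> C] is the same thing as a function
[(x, b) |-> f x_b] into [C] that obeys the relations.  Read as a family of maps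
[u x : b |-> f x_b], these relations are word for word the axioms of a
[B]-representation [u] of [A]: bilinearity together with [|x_b| = |x| + |b|]
says that [u] is linear, degree preserving and takes values in [H_B(C)]; the
relations for [(xy)_b] and [1_b] say that [u] turns products into convolution
products and [1] into the unit; those for [x_(bc)] and [x_1] are the two axioms
that distinguish representations among the homomorphisms [A -> H_B(C)].

From [u] to [f], the value of a noncommutative polynomial in the [x_b] is
computed in [C] and shown to be invariant under the congruence ([eval_eq]);
this gives [hat_lift].  From [f] to [u] one reads off the values on generators
([rep_of]); the point to check is that [b |-> f x_b] is a finite sum of
homogeneous maps, and it is because [x] is a finite sum of homogeneous
elements.  The two passages are mutually inverse, and natural in [C], because a
homomorphism is determined by its values on the generators ([hat_hom_ext]).

For commutative [C], the homomorphism [hat_lift u] respects the commutation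
relations because it sends [x_b], for homogeneous [x] and [b], to an element of
degree [|x| + |b|] of [C].  It therefore factors uniquely through the quotient
[cgr_hat A B] of [gr_hat A B] ([quot_lift], [cgr_hat_hom_ext]). *)

Set Implicit Arguments.
Unset Strict Implicit.
Unset Printing Implicit Defensive.

Import GRing.Theory.
Local Open Scope ring_scope.

(** * From representations to homomorphisms *)

Section Evaluation.
Variables (K : comPzRingType) (A B : grBialgebra K) (C : grAlgebra K).
Variable u : bRep A B C.

Lemma rep_bilin : bilin (fun (x : A) (b : B) => homB_fun (u x) b).
Proof.
split=> [b k x y|x]; last exact: homB_linear.
by rewrite linearP.
Qed.

Lemma rep_homog p q (x : A) (b : B) :
  homog p x -> homog q b -> homog (p + q) (homB_fun (u x) b).
Proof.
move=> hx hb; have [_ uxh] : hom_homog p (homB_fun (u x)).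
  exact: (grHom_homog u hx).
by rewrite addrC; apply: uxh.
Qed.

Lemma rep_bilinB (x y : A) :
  bilin (fun b c : B => homB_fun (u x) b * homB_fun (u y) c).
Proof.
split=> [c|b] k d d' /=; rewrite homB_linear.
  by rewrite mulrDl gr_scalerAl.
by rewrite mulrDr gr_scalerAr.
Qed.

Lemma rep_bilinA (b c : B) :
  bilin (fun x y : A => homB_fun (u x) b * homB_fun (u y) c).
Proof.
split=> [y|x] k z z' /=.
  by rewrite (rep_bilin.1 b) mulrDl gr_scalerAl.
by rewrite (rep_bilin.1 c) mulrDr gr_scalerAr.
Qed.

Fixpoint eval (t : hat_term K A B) : C :=
  match t with
  | HGen x b => homB_fun (u x) b
  | HConst k => k *: (1 : C)
  | HAdd s t => eval s + eval t
  | HMul s t => eval s * eval t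
  end.

Lemma eval_sum (I : Type) (s : seq I) (F : I -> hat_term K A B) :
  eval (HSum [seq F i | i <- s]) = \sum_(i <- s) eval (F i).
Proof.
elim: s => [|i s IH] /=; first by rewrite big_nil scale0r.
by rewrite big_cons -IH.
Qed.

(** The algebra laws in the congruence hold in [C], and its relations between
generators are the axioms of a representation. *)
Lemma eval_eq s t : hat_eq s t -> eval s = eval t.
Proof.
elim=> {s t} //=.
- by move=> s t r _ -> _ ->.
- by move=> s s' t t' _ -> _ ->.
- by move=> s s' t t' _ -> _ ->.
- by move=> s t r; rewrite addrA.
- by move=> s t; rewrite addrC.
- by move=> s; rewrite scale0r add0r.
- by move=> s t r; rewrite mulrA.
- by move=> s; rewrite scale1r mul1r.
- by move=> s; rewrite scale0r mul0r.
- by move=> s t r; rewrite mulrDl.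
- by move=> s t r; rewrite mulrDr.
- by move=> k l; rewrite scalerDl.
- by move=> k l; rewrite -gr_scalerAl mul1r scalerA.
- by move=> k s; rewrite -gr_scalerAl -gr_scalerAr mul1r mulr1.
- by move=> k x y b; rewrite (rep_bilin.1 b) -gr_scalerAl mul1r.
- by move=> k x b c; rewrite (rep_bilin.2 x) -gr_scalerAl mul1r.
- move=> x y b s e; rewrite eval_sum grHomM.
  by rewrite -[LHS]/(convol (u x) (u y) b) /convol e (tlift_sum (rep_bilinB x y)).
- by move=> b; rewrite grHom1.
- by move=> x b c s e; rewrite eval_sum bRep_mul e (tlift_sum (rep_bilinA b c)).
- by move=> x; rewrite bRep_unit.
Qed.

Definition hat_lift_fun (w : gr_hat A B) : C := eval (hat_repr w).

Lemma hat_lift_pi s : hat_lift_fun (hat_pi s) = eval s.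
Proof. exact/eval_eq/hat_reprK. Qed.

Lemma hat_lift_linear : linear hat_lift_fun.
Proof.
move=> k; elim/hat_split=> s; elim/hat_split=> t.
rewrite -[_ + _]/(k *: hat_pi s + hat_pi t) -hat_piZ -hat_piD !hat_lift_pi /=.
by rewrite -gr_scalerAl mul1r.
Qed.

Lemma hat_lift_monoid : monoid_morphism hat_lift_fun.
Proof.
split=> [|]; first by rewrite -[1]/(hat_pi (HConst 1)) hat_lift_pi /= scale1r.
elim/hat_split=> s; elim/hat_split=> t.
by rewrite -[_ * _]/(hat_mulop (hat_pi s) (hat_pi t)) -hat_piM !hat_lift_pi.
Qed.

Lemma hat_lift_homog p (w : gr_hat A B) : homog p w -> homog p (hat_lift_fun w).
Proof.
elim=> {p w} [p|p k v w _ hv _ hw||p q v w _ hv _ hw|p q x b hx hb].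
- by rewrite (linear0_of hat_lift_linear); apply: homog0.
- by rewrite hat_lift_linear; apply: homogP.
- by rewrite [hat_lift_fun _]hat_lift_monoid.1; apply: homog1.
- by rewrite [hat_lift_fun _]hat_lift_monoid.2; apply: homogM.
- by rewrite hat_lift_pi; apply: rep_homog.
Qed.

Definition hat_lift : grHom (gr_hat A B) C :=
  grHom_of hat_lift_linear hat_lift_monoid hat_lift_homog.

Lemma hat_lift_gen x b : hat_lift (hgen x b) = homB_fun (u x) b.
Proof. exact: hat_lift_pi. Qed.
End Evaluation.

(** * From homomorphisms to representations *)

Lemma hat_hom_ext (K : comPzRingType) (A B : grBialgebra K) (C : grAlgebra K)
    (f g : grHom (gr_hat A B) C) :
  (forall x b, f (hgen x b) = g (hgen x b)) -> f = g.
Proof.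
move=> e; apply: grHom_ext; elim/hat_elim=> [//||k v w hv hw|v w hv hw].
- by rewrite [LHS]grHom1 [RHS]grHom1.
- by rewrite [LHS]linearP [RHS]linearP hv hw.
- by rewrite [LHS]grHomM [RHS]grHomM hv hw.
Qed.

Section Representation.
Variables (K : comPzRingType) (A B : grBialgebra K) (C : grAlgebra K).
Variable f : grHom (gr_hat A B) C.

Definition hom_value (x : A) (b : B) : C := f (hgen x b).

Lemma hom_value_bilin : bilin hom_value.
Proof.
split=> [b|x] k y z; rewrite /hom_value.
  by rewrite (hgen_bilin A B).1; apply: linearP.
by rewrite (hgen_bilin A B).2; apply: linearP.
Qed.

Lemma hom_value_homog p (x : A) : homog p x -> hom_homog p (hom_value x).
Proof.
move=> hx; split=> [|k b hb]; first exact: hom_value_bilin.2.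
by rewrite addrC; apply: grHom_homog; apply: hat_homog_gen.
Qed.

(** [hom_value] is additive in its first argument, so the decomposition of [x]
into homogeneous elements yields one of [hom_value x]. *)
Lemma hom_value_mem x : homB_pred (hom_value x).
Proof.
apply/asboolP; elim/homog_ind: x => [|x y hx hy|p x hx].
- rewrite (_ : hom_value 0 = 0); first exact: fin_sum0.
  by apply/funext => b; apply: (linear0_of (hom_value_bilin.1 b)).
- rewrite (_ : hom_value (x + y) = hom_value x + hom_value y).
    exact: fin_sumD.
  by apply/funext => b; apply: bilinDl hom_value_bilin.
- by apply: (@fin_sum1 _ _ p); apply: hom_value_homog.
Qed.

Definition rep_fun (x : A) : gr_homB B C := HomB (hom_value_mem x).

Lemma rep_fun_linear : linear rep_fun.
Proof.
by move=> k x y; apply: homB_ext => b; apply: (hom_value_bilin.1 b).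
Qed.

Lemma hom_linear : linear f. Proof. by move=> k v w; rewrite linearP. Qed.

Lemma rep_fun_monoid : monoid_morphism rep_fun.
Proof.
split=> [|x y]; apply: homB_ext => b.
  rewrite -[LHS]/(f (hgen 1 b)) hgen1l.
  by rewrite [LHS]linearZ; congr (_ *: _); apply: grHom1.
rewrite -[LHS]/(f (hgen (x * y) b)) hgenMl [LHS](tlift_comp _ _ hom_linear).
by apply: eq_tlift => b' b''; apply: grHomM.
Qed.

Definition rep_hom : grHom A (gr_homB B C) :=
  grHom_of rep_fun_linear rep_fun_monoid hom_value_homog.

Lemma rep_hom_unit (x : A) :
  homB_fun (rep_hom x) 1 = (counit A x : K) *: (1 : C).
Proof.
rewrite -[LHS]/(f (hgen x 1)) hgen1r.
by rewrite [LHS]linearZ; congr (_ *: _); apply: grHom1.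
Qed.

Lemma rep_hom_mul (x : A) (b c : B) : homB_fun (rep_hom x) (b * c)
  = tlift (fun x' x'' => homB_fun (rep_hom x') b * homB_fun (rep_hom x'') c)
      (comul A x).
Proof.
rewrite -[LHS]/(f (hgen x (b * c))) hgenMr [LHS](tlift_comp _ _ hom_linear).
by apply: eq_tlift => x' x''; apply: grHomM.
Qed.

Definition rep_of : bRep A B C := BRep rep_hom_unit rep_hom_mul.
End Representation.

Lemma hat_liftK (K : comPzRingType) (A B : grBialgebra K) (C : grAlgebra K) :
  cancel (@hat_lift K A B C) (@rep_of K A B C).
Proof. by move=> u; apply: bRep_ext => x b; apply: hat_lift_gen. Qed.

Lemma rep_ofK (K : comPzRingType) (A B : grBialgebra K) (C : grAlgebra K) :
  cancel (@rep_of K A B C) (@hat_lift K A B C).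
Proof. by move=> f; apply: hat_hom_ext => x b; rewrite hat_lift_gen. Qed.

Lemma hat_lift_natural (K : comPzRingType) (A B : grBialgebra K)
    (C C' : grAlgebra K) (f : grHom C C') (u : bRep A B C) :
  hat_lift (bRep_map f u) = grHom_comp f (hat_lift u).
Proof.
apply: hat_hom_ext => x b; rewrite hat_lift_gen.
by congr (f _); rewrite hat_lift_gen.
Qed.

(** * Homomorphisms out of a quotient *)

Section QuotientLift.
Variables (K : comPzRingType) (G : grAlgebra K) (r : homRel G).

Definition quot_proj_fun (x : G) : gr_quot r := quot_pi r x.

Lemma quot_proj_linear : linear quot_proj_fun.
Proof. exact: quot_pi_linear. Qed.

Lemma quot_proj_monoid : monoid_morphism quot_proj_fun.
Proof. by split=> [|x y] //; apply: quot_piM. Qed.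

Lemma quot_proj_homog p (x : G) : homog p x -> homog p (quot_proj_fun x).
Proof. by exists x. Qed.

Definition quot_proj : grHom G (gr_quot r) :=
  grHom_of quot_proj_linear quot_proj_monoid quot_proj_homog.

Variables (D : grAlgebra K) (f : grHom G D).
Hypothesis f_rel : forall x y, r x y -> f x = f y.

Lemma quot_eq_hom x y : quot_eq r x y -> f x = f y.
Proof.
elim=> {x y} // [x y z _ -> _ //|k x x' y y' _ hx _ hy|x x' y y' _ hx _ hy].
  by rewrite !linearP hx hy.
by rewrite !grHomM hx hy.
Qed.

Definition quot_lift_fun (v : gr_quot r) : D := f (quot_repr v).

Lemma quot_lift_pi x : quot_lift_fun (quot_pi r x) = f x.
Proof. exact/quot_eq_hom/quot_reprK. Qed.

Lemma quot_lift_linear : linear quot_lift_fun.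
Proof.
move=> k; elim/quot_split=> x; elim/quot_split=> y.
rewrite -[_ + _]/(k *: quot_pi r x + quot_pi r y) -quot_pi_linear.
by rewrite !quot_lift_pi linearP.
Qed.

Lemma quot_lift_monoid : monoid_morphism quot_lift_fun.
Proof.
split; first by rewrite -[1]/(quot_pi r 1) quot_lift_pi grHom1.
elim/quot_split=> x; elim/quot_split=> y.
rewrite -[_ * _]/(quot_mulop (quot_pi r x) (quot_pi r y)) -quot_piM.
by rewrite !quot_lift_pi grHomM.
Qed.

Lemma quot_lift_homog p v : homog p v -> homog p (quot_lift_fun v).
Proof. by case=> x hx ->; rewrite quot_lift_pi; apply: grHom_homog. Qed.

Definition quot_lift : grHom (gr_quot r) D :=
  grHom_of quot_lift_linear quot_lift_monoid quot_lift_homog.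
End QuotientLift.

(** * Commutative coefficients *)

Section Commutative.
Variables (K : comPzRingType) (A B : grBialgebra K).

Definition cgr_proj : grHom (gr_hat A B) (cgr_hat A B) :=
  quot_proj (comm_homRel A B).

Lemma cgr_hat_hom_ext (C : grAlgebra K) (f g : grHom (cgr_hat A B) C) :
  (forall x b, f (cgr_proj (hgen x b)) = g (cgr_proj (hgen x b))) -> f = g.
Proof.
move=> e; have {}e : grHom_comp f cgr_proj = grHom_comp g cgr_proj.
  exact: hat_hom_ext.
apply: grHom_ext; elim/quot_split=> w.
by rewrite -[LHS]/(grHom_comp f cgr_proj w) e.
Qed.

Variable C : cgrAlgebra K.

(** [hat_lift u] maps [x_b] into degree [|x| + |b|], the degree that governs the
sign in the commutation relation; this relation thus becomes an instance of the
graded commutativity of [C]. *)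
Lemma hat_lift_comm (u : bRep A B C) v w :
  comm_homRel A B v w -> hat_lift u v = hat_lift u w.
Proof.
case=> p q p' q' x y b c hx hb hy hc.
rewrite [RHS]linearZ [LHS]grHomM [X in _ = _ *: X]grHomM.
by rewrite !hat_lift_gen; apply: cgr_commute; apply: rep_homog.
Qed.

Definition cgr_lift (u : bRep A B C) : grHom (cgr_hat A B) C :=
  quot_lift (@hat_lift_comm u).

Lemma cgr_lift_gen u x b :
  cgr_lift u (cgr_proj (hgen x b)) = homB_fun (u x) b.
Proof. by rewrite [LHS](quot_lift_pi (@hat_lift_comm u)) [LHS]hat_lift_gen. Qed.

Definition cgr_rep (f : grHom (cgr_hat A B) C) : bRep A B C :=
  rep_of (grHom_comp f cgr_proj).

Lemma cgr_liftK : cancel cgr_lift cgr_rep.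
Proof. by move=> u; apply: bRep_ext => x b; apply: cgr_lift_gen. Qed.

Lemma cgr_repK : cancel cgr_rep cgr_lift.
Proof. by move=> f; apply: cgr_hat_hom_ext => x b; rewrite cgr_lift_gen. Qed.
End Commutative.

Lemma cgr_lift_natural (K : comPzRingType) (A B : grBialgebra K)
    (C C' : cgrAlgebra K) (f : grHom C C') (u : bRep A B C) :
  cgr_lift (C := C') (bRep_map f u) = grHom_comp f (cgr_lift u).
Proof.
apply: cgr_hat_hom_ext => x b; rewrite cgr_lift_gen.
by congr (f _); rewrite cgr_lift_gen.
Qed.

Theorem lemma3p1 (K : comPzRingType) (A B : grBialgebra K) :
  (exists Phi : forall C : grAlgebra K, bRep A B C -> grHom (gr_hat A B) C,
    (forall C : grAlgebra K, bijective (Phi C)) /\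
    (forall (C C' : grAlgebra K) (f : grHom C C') (u : bRep A B C),
      Phi C' (bRep_map f u) = grHom_comp f (Phi C u)))
  /\
  (exists Psi : forall C : cgrAlgebra K, bRep A B C -> grHom (cgr_hat A B) C,
    (forall C : cgrAlgebra K, bijective (Psi C)) /\
    (forall (C C' : cgrAlgebra K) (f : grHom C C') (u : bRep A B C),
      Psi C' (bRep_map f u) = grHom_comp f (Psi C u))).
Proof.
split.
  exists (fun C => @hat_lift K A B C); split=> [C|]; last exact: hat_lift_natural.
  by exists (@rep_of K A B C); [apply: hat_liftK|apply: rep_ofK].
exists (fun C => @cgr_lift K A B C); split=> [C|]; last exact: cgr_lift_natural.
by exists (@cgr_rep K A B C); [apply: cgr_liftK|apply: cgr_repK].
Qed.
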